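(* Let $0<\varepsilon<1$ and let $F_\varepsilon$ be the Katok--Ziller metric on $\mathbb{S}^2$ given in spherical coordinates by $$F_\varepsilon(\phi,\theta;\xi_\phi,\xi_\theta)=\frac{1}{1-\varepsilon^2\sin^2\phi}\left(\sqrt{(1-\varepsilon^2\sin^2\phi)\,\xi_\phi^2+\sin^2\phi\;\xi_\theta^2}-\varepsilon\sin^2\phi\;\xi_\theta\right).$$ Then the Finsler--Laplace operator of $(\mathbb{S}^2,F_\varepsilon)$ is $$\Delta^{F_\varepsilon}=\frac{2}{1+\sqrt{1-\varepsilon^2\sin^2\phi}}\left[\frac{(1-\varepsilon^2\sin^2\phi)^{3/2}}{\sin^2\phi}\frac{\partial^2}{\partial\theta^2}+(1-\varepsilon^2\sin^2\phi)\frac{\partial^2}{\partial\phi^2}+\frac{\cos\phi}{\sin\phi}\left(\varepsilon^2\sin^2\phi+\sqrt{1-\varepsilon^2\sin^2\phi}\right)\frac{\partial}{\partial\phi}\right].$$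
   Context: Coordinates on $\mathbb{S}^2$: $\phi\in[0,\pi]$ (colatitude), $\theta\in[0,2\pi]$ (longitude), with $(\xi_\phi,\xi_\theta)$ the associated coordinates on tangent spaces. For a Finsler metric $F$ on an oriented $n$-manifold $M$ (continuous $F\colon TM\to[0,\infty)$, smooth off the zero section, positively homogeneous of degree one, positive-definite, strongly convex): $HM:=(TM\smallsetminus\{\text{zero section}\})/\mathbb{R}^+$, with quotient map $r\colon TM\smallsetminus 0\to HM$, projection $\pi\colon HM\to M$, fibers $H_xM$, vertical bundle $VHM=\ker d\pi$. The Hilbert form is the contact 1-form $A$ on $HM$ with $r^*A=\frac{\partial F}{\partial v^i}dx^i$; its Reeb field $X$ satisfies $A(X)=1$, $i_XdA=0$. $HM$ is oriented by $A\wedge dA^{n-1}$ and the fibers $H_xM$ so that fiber orientation followed by base orientation is that of $HM$. There is a unique volume form $\Omega^F$ on $M$ for which there is an $(n-1)$-form $\alpha^F$ on $HM$, nowhere zero on $VHM$ (and uniquely determined there), with $\alpha^F\wedge\pi^*\Omega^F=A\wedge dA^{n-1}$ and $\int_{H_xM}\alpha^F=\mathrm{vol}_{\mathrm{Eucl}}(\mathbb{S}^{n-1})$ for all $x$. The Finsler--Laplace operator is $\Delta^Ff(x)=\frac{n}{\mathrm{vol}_{\mathrm{Eucl}}(\mathbb{S}^{n-1})}\int_{H_xM}L_X^2(\pi^*f)\,\alpha^F$. Here $n=2$ and $M=\mathbb{S}^2$. *)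

(* Defs.v *)
From Stdlib Require Import Reals.
From Coquelicot Require Import Coquelicot.
Local Open Scope R_scope.

(** * Vectors of R^3 and pairs of them *)

Definition vec : Type := (R * R * R)%type.
Definition mkvec (x y z : R) : vec := (x, y, z).
Definition cx (a : vec) : R := fst (fst a).
Definition cy (a : vec) : R := snd (fst a).
Definition cz (a : vec) : R := snd a.

Definition vzero : vec := mkvec 0 0 0.
Definition vadd (a b : vec) : vec := mkvec (cx a + cx b) (cy a + cy b) (cz a + cz b).
Definition vscal (c : R) (a : vec) : vec := mkvec (c * cx a) (c * cy a) (c * cz a).
Definition dot (a b : vec) : R := cx a * cx b + cy a * cy b + cz a * cz b.
Definition cross (a b : vec) : vec :=
  mkvec (cy a * cz b - cz a * cy b) (cz a * cx b - cx a * cz b) (cx a * cy b - cy a * cx b).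
Definition vnormalize (a : vec) : vec := vscal (/ sqrt (dot a a)) a.
Definition vDerive (c : R -> vec) (s : R) : vec :=
  mkvec (Derive (fun r => cx (c r)) s) (Derive (fun r => cy (c r)) s)
        (Derive (fun r => cz (c r)) s).

Definition vec2 : Type := (vec * vec)%type.
Definition vadd2 (z w : vec2) : vec2 := (vadd (fst z) (fst w), vadd (snd z) (snd w)).
Definition vscal2 (c : R) (z : vec2) : vec2 := (vscal c (fst z), vscal c (snd z)).
Definition vDerive2 (c : R -> vec2) (s : R) : vec2 :=
  (vDerive (fun r => fst (c r)) s, vDerive (fun r => snd (c r)) s).

(** * The unit sphere and smooth functions on it *)

Definition S2 (p : vec) : Prop := dot p p = 1.
Definition TS2 (p v : vec) : Prop := dot p v = 0.

Fixpoint Ck (k : nat) (f : vec -> R) : Prop :=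
  (forall x : vec, continuous f x) /\
  match k with
  | O => True
  | S j => forall v : vec,
      (forall x, ex_derive (fun s => f (vadd x (vscal s v))) 0) /\
      Ck j (fun x => Derive (fun s => f (vadd x (vscal s v))) 0)
  end.

(* S^2 is a closed submanifold of R^3, so its smooth functions are the
   restrictions of the smooth functions on R^3. *)
Definition smooth_on_S2 (f : vec -> R) : Prop :=
  exists g : vec -> R, (forall k, Ck k g) /\ forall p, S2 p -> f p = g p.

(** * The homogenized tangent bundle HM of M = S^2

   Every ray of nonzero tangent vectors contains exactly one vector of Euclidean
   length 1, so (TM \ 0)/R^+ is identified with the pairs (p, u) where p is a
   point of the sphere and u a Euclidean-unit tangent vector at p; under this
   identification the projection to M is [fst]. *)

Definition HM (z : vec2) : Prop :=
  S2 (fst z) /\ TS2 (fst z) (snd z) /\ dot (snd z) (snd z) = 1.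

(* Tangent space of HM at z, in R^3 x R^3; d(pi) is [fst] and VHM is [fst w = 0]. *)
Definition THM (z w : vec2) : Prop :=
  dot (fst z) (fst w) = 0 /\ dot (snd z) (snd w) = 0 /\
  dot (fst w) (snd z) + dot (fst z) (snd w) = 0.

Definition form1 : Type := vec2 -> vec2 -> R.
Definition form2 : Type := vec2 -> vec2 -> vec2 -> R.

Definition is_form1_HM (b : form1) : Prop :=
  forall z, HM z -> forall c w1 w2, THM z w1 -> THM z w2 ->
    b z (vadd2 (vscal2 c w1) w2) = c * b z w1 + b z w2.

Definition wedge12 (b : form1) (w : form2) (z w1 w2 w3 : vec2) : R :=
  b z w1 * w z w2 w3 + b z w2 * w z w3 w1 + b z w3 * w z w1 w2.

(* Gram-Schmidt: a smooth retraction onto HM of the open set of linearly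
   independent pairs.  Objects on HM are differentiated after being pulled back
   to this open set; since the retraction restricts to the identity on HM, the
   results on vectors tangent to HM are the intrinsic derivatives. *)
Definition retr (z : vec2) : vec2 :=
  let p := vnormalize (fst z) in
  (p, vnormalize (vadd (snd z) (vscal (- dot (snd z) p) p))).

Definition Lie (X : vec2 -> vec2) (h : vec2 -> R) (z : vec2) : R :=
  Derive (fun s => h (retr (vadd2 z (vscal2 s (X z))))) 0.

Definition pullback_retr (b : form1) : form1 := fun x w =>
  b (retr x) (vDerive2 (fun s => retr (vadd2 x (vscal2 s w))) 0).

(* d b (w1, w2) = w1 (b w2) - w2 (b w1) for constant vector fields w1, w2 *)
Definition dform (b : form1) : form2 := fun z w1 w2 =>
  Derive (fun s => pullback_retr b (vadd2 z (vscal2 s w1)) w2) 0 -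
  Derive (fun s => pullback_retr b (vadd2 z (vscal2 s w2)) w1) 0.

(** * The Finsler-Laplace operator of a Finsler metric F on S^2 (n = 2)

   [F p v] is only used for v tangent to the sphere at p. *)

(* (dF/dv^i) dx^i : the derivative of F along the fibre in the direction d(pi) w *)
Definition hilbert (F : vec -> vec -> R) : form1 := fun z w =>
  Derive (fun s => F (fst z) (vadd (snd z) (vscal s (fst w)))) 0.

Definition AdA (F : vec -> vec -> R) : vec2 -> vec2 -> vec2 -> vec2 -> R :=
  wedge12 (hilbert F) (dform (hilbert F)).

Definition is_reeb (F : vec -> vec -> R) (X : vec2 -> vec2) : Prop :=
  forall z, HM z ->
    THM z (X z) /\ hilbert F z (X z) = 1 /\
    forall w, THM z w -> dform (hilbert F) z (X z) w = 0.

(* Velocity at (p, u) of the Euclidean parametrization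
   t |-> (p, cos t e + sin t (p x e)) of the fibre. *)
Definition vert (z : vec2) : vec2 := (vzero, cross (fst z) (snd z)).

(* S^2 is oriented by its outward normal: (u, p x u) is a positive basis of T_pS^2,
   and (u, -p), (p x u, 0) are vectors tangent to HM at (p, u) above it.
   [fiber_sign] is 1 if [vert] is positive for the orientation of the fibre such
   that fibre followed by base is the orientation AdA of HM, and -1 otherwise. *)
Definition fiber_sign (F : vec -> vec -> R) (z : vec2) : R :=
  sign (AdA F z (vert z) (snd z, vscal (-1) (fst z)) (cross (fst z) (snd z), vzero)).

Definition fiber_pt (p e : vec) (t : R) : vec2 :=
  (p, vadd (vscal (cos t) e) (vscal (sin t) (cross p e))).

(* Integral of b over the oriented fibre H_pM; e is any unit tangent vector at p
   and only fixes the origin of the parametrization. *)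
Definition fiber_integral (F : vec -> vec -> R) (b : form1) (p e : vec) : R :=
  RInt (fun t => let z := fiber_pt p e t in fiber_sign F z * b z (vert z)) 0 (2 * PI).

Definition is_volume_form_S2 (Omega : vec -> vec -> vec -> R) : Prop :=
  forall p, S2 p ->
    (forall c a b d, TS2 p a -> TS2 p b -> TS2 p d ->
       Omega p (vadd (vscal c a) b) d = c * Omega p a d + Omega p b d) /\
    (forall a b, TS2 p a -> TS2 p b -> Omega p a b = - Omega p b a) /\
    (exists a b, TS2 p a /\ TS2 p b /\ Omega p a b <> 0).

Definition pullback_S2 (Omega : vec -> vec -> vec -> R) : form2 :=
  fun z w1 w2 => Omega (fst z) (fst w1) (fst w2).

(* Smoothness of X, Omega and of alpha on VHM is not imposed separately: the
   conditions below determine them pointwise. *)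
Definition is_angle_volume
    (F : vec -> vec -> R) (alpha : form1) (Omega : vec -> vec -> vec -> R) : Prop :=
  is_form1_HM alpha /\
  is_volume_form_S2 Omega /\
  (forall z w, HM z -> THM z w -> fst w = vzero -> w <> (vzero, vzero) ->
     alpha z w <> 0) /\
  (forall z w1 w2 w3, HM z -> THM z w1 -> THM z w2 -> THM z w3 ->
     wedge12 alpha (pullback_S2 Omega) z w1 w2 w3 = AdA F z w1 w2 w3) /\
  (forall p e, HM (p, e) -> fiber_integral F alpha p e = 2 * PI).

Definition is_finsler_laplacian
    (F : vec -> vec -> R) (Delta : (vec -> R) -> vec -> R) : Prop :=
  exists (X : vec2 -> vec2) (alpha : form1) (Omega : vec -> vec -> vec -> R),
    is_reeb F X /\ is_angle_volume F alpha Omega /\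
    forall f, smooth_on_S2 f -> forall p e, HM (p, e) ->
      Delta f p =
        2 / (2 * PI) *
        fiber_integral F
          (fun z w => Lie X (Lie X (fun z' => f (fst z'))) z * alpha z w) p e.

(** * Spherical coordinates and the Katok-Ziller metric *)

Definition sph (phi theta : R) : vec :=
  mkvec (sin phi * cos theta) (sin phi * sin theta) (cos phi).
Definition sph_phi (phi theta : R) : vec :=
  mkvec (cos phi * cos theta) (cos phi * sin theta) (- sin phi).
Definition sph_theta (phi theta : R) : vec :=
  mkvec (- (sin phi * sin theta)) (sin phi * cos theta) 0.

(* At the poles the tangent vectors are the xi_phi * sph_phi, with theta varying, so
   that these equations determine F on the whole tangent bundle. *)
Definition is_katok_ziller (eps : R) (F : vec -> vec -> R) : Prop :=
  forall phi theta xi_phi xi_theta,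
    0 <= phi <= PI -> 0 <= theta <= 2 * PI ->
    F (sph phi theta)
      (vadd (vscal xi_phi (sph_phi phi theta)) (vscal xi_theta (sph_theta phi theta))) =
    / (1 - eps ^ 2 * sin phi ^ 2) *
      (sqrt ((1 - eps ^ 2 * sin phi ^ 2) * xi_phi ^ 2 + sin phi ^ 2 * xi_theta ^ 2)
       - eps * sin phi ^ 2 * xi_theta).

(* Main.v *)
Require Import Defs.
From Stdlib Require Import Reals Lra ClassicalEpsilon.
From Coquelicot Require Import Coquelicot.
Local Open Scope R_scope.

(** Let [W] be [eps] times the rotation field about the vertical axis. The
   Katok-Ziller metric solves Zermelo's navigation problem on the round sphere for
   the wind [W]: [F p v] is the positive root [r] of [|v / r - W| = 1]
   ([katok_ziller_zermelo]).

   For [z = (p, u)] in HM put [q = p x u] and write [k] for third coordinates, so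
   that [p_k^2 + u_k^2 + q_k^2 = 1]. With [root = sqrt (1 - (eps u_k)^2)],
   [drift = eps q_k] and [slack = 1 - |W|^2] one has [root^2 - drift^2 = slack], and
   [F p u = (root - drift) / slack = 1 / (root + drift)]: along a fibre everything is
   expressed by the two numbers [u_k] and [q_k], which rotate into each other.

   HM is parallelized by [(u, -p)], [(q, 0)] and the vertical [(0, q)]; let
   [w1, w2, w3] be the dual coordinates. Then the Hilbert form is
   [A = F w1 + F' w2], with [F'] the derivative of [F] along the fibre, and
   [dA = twist w1 ^ w2 + root^(-3) w3 ^ w2] ([dform_hilbert]), whence
   [A ^ dA = - F root^(-3) w3 ^ w1 ^ w2]. Since this vanishes nowhere, the Reeb
   field is unique ([is_reeb_unique]) and known explicitly, and every angle form is a
   multiple, constant on each fibre, of [F root^(-3) w3] on vertical vectors. The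
   multiple is fixed by the total mass: the integral of [F root^(-3)] over a fibre is
   [2 PI slack^(-3/2)] ([RInt_liouville], [angle_volume_unique]).

   Two derivatives of a function [g] along the Reeb field give a combination of the
   second derivative of [g] in the direction [u] and of its first derivatives in the
   directions [p], [u], [q], with coefficients in [root] and [drift]
   ([Lie_Lie_reeb]). The half turn of the fibre reverses [u], [q] and [drift] and
   keeps [root]; averaging over it turns the integrand into
   [slack^(3/2) / root^2 * (D^2 g (u, u) - D_p g - eps^2 p_k / slack * D_h g)], where
   [h] is the tangential part of the vertical unit vector ([RInt_fiber_profile]).
   This is a rational function of [cos t] and [sin t] with an elementary
   antiderivative, continuous on the whole fibre ([fiber_angle]). Comparing
   [D^2 g] and [D g] with the derivatives of [g] along meridians and parallels
   ([Derive_2_sph_phi], [Derive_2_sph_theta]) gives the formula. Rotating the origin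
   of the fibre translates a periodic integrand, so the integral depends on [p] only
   and the operator exists.

   Differentiation takes place along curves [retr (z + s w)]. They stay in HM and
   start with velocity [w] ([is_vderive_retr_curve]); along them a function with
   continuous directional derivatives obeys the chain rule ([smooth_chain]). *)

(** * Orthonormal frames on the unit tangent bundle *)

Ltac pair_eq := repeat match goal with |- (_, _) = (_, _) => apply f_equal2 end.

Ltac vec_ring :=
  intros;
  repeat match goal with
    | z : vec2 |- _ => destruct z
    | a : vec |- _ => destruct a as [[? ?] ?] end;
  unfold vadd2, vscal2, dot, cross, vadd, vscal, vzero, mkvec, cx, cy, cz in *;
  cbn [fst snd] in *;
  pair_eq; ring.

Lemma vec_eq (a b : vec) : cx a = cx b -> cy a = cy b -> cz a = cz b -> a = b.
Proof.
  destruct a as [[a1 a2] a3], b as [[b1 b2] b3].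
  unfold cx, cy, cz; cbn; intros -> -> ->; reflexivity.
Qed.

Lemma dot_comm (a b : vec) : dot a b = dot b a.
Proof. vec_ring. Qed.

Lemma dot_vadd_l (a b c : vec) : dot (vadd a b) c = dot a c + dot b c.
Proof. vec_ring. Qed.

Lemma dot_vadd_r (a b c : vec) : dot c (vadd a b) = dot c a + dot c b.
Proof. vec_ring. Qed.

Lemma dot_vscal_l (k : R) (a b : vec) : dot (vscal k a) b = k * dot a b.
Proof. vec_ring. Qed.

Lemma dot_vscal_r (k : R) (a b : vec) : dot b (vscal k a) = k * dot b a.
Proof. vec_ring. Qed.

Lemma dot_cross_l (a b : vec) : dot a (cross a b) = 0.
Proof. vec_ring. Qed.

Lemma dot_cross_r (a b : vec) : dot b (cross a b) = 0.
Proof. vec_ring. Qed.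

Lemma dot_self_ge0 (a : vec) : 0 <= dot a a.
Proof. unfold dot; nra. Qed.

Lemma dot_cross_self (a b : vec) :
  dot (cross a b) (cross a b) = dot a a * dot b b - dot a b ^ 2.
Proof. vec_ring. Qed.

Lemma cross_cross_l (a b c : vec) :
  cross a (cross b c) = vadd (vscal (dot a c) b) (vscal (- dot a b) c).
Proof. vec_ring. Qed.

(** Expand [q x (c x q)], with [q = a x b], by the triple product in two ways. *)
Lemma cross_basis_expand (a b c : vec) :
  vscal (dot (cross a b) (cross a b)) c =
  vadd (vadd (vscal (dot c a * dot b b - dot c b * dot a b) a)
             (vscal (dot c b * dot a a - dot c a * dot a b) b))
       (vscal (dot c (cross a b)) (cross a b)).
Proof. vec_ring. Qed.

Definition normal (z : vec2) : vec := cross (fst z) (snd z).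

Lemma normal_unit (z : vec2) : HM z -> dot (normal z) (normal z) = 1.
Proof.
  intros [Hp [Hpu Hu]]; unfold normal, S2, TS2 in *.
  rewrite dot_cross_self, Hp, Hpu, Hu; ring.
Qed.

Lemma HM_expand (z : vec2) (c : vec) : HM z ->
  c = vadd (vadd (vscal (dot c (fst z)) (fst z)) (vscal (dot c (snd z)) (snd z)))
           (vscal (dot c (normal z)) (normal z)).
Proof.
  intros H; pose proof (normal_unit z H) as Hn; destruct H as [Hp [Hpu Hu]].
  pose proof (cross_basis_expand (fst z) (snd z) c) as E.
  unfold normal, S2, TS2 in *; rewrite Hn, Hp, Hpu, Hu in E.
  transitivity (vscal 1 c); [ | rewrite E; f_equal; f_equal; f_equal; ring].
  destruct c as [[? ?] ?]; unfold vscal, mkvec, cx, cy, cz; cbn.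
  rewrite !Rmult_1_l; reflexivity.
Qed.

(** The vertical unit vector has length one in the frame [p], [u], [p x u]. The metric
   sees a frame only through these three components. *)
Lemma HM_cz_squares (z : vec2) : HM z ->
  cz (fst z) ^ 2 + cz (snd z) ^ 2 + cz (normal z) ^ 2 = 1.
Proof.
  intros H; pose proof (f_equal cz (HM_expand z (mkvec 0 0 1) H)) as E.
  set (n := normal z) in *; clearbody n; revert E.
  destruct z as [[[? ?] ?] [[? ?] ?]], n as [[? ?] ?].
  unfold vadd, vscal, dot, mkvec, cx, cy, cz; cbn; intros E.
  nra.
Qed.

Lemma cross_fst_normal (z : vec2) : HM z -> cross (fst z) (normal z) = vscal (-1) (snd z).
Proof.
  intros [Hp [Hpu Hu]]; unfold normal, S2, TS2 in *.
  rewrite cross_cross_l, Hp, Hpu; vec_ring.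
Qed.

Lemma cross_normal_snd (z : vec2) : HM z -> cross (normal z) (snd z) = vscal (-1) (fst z).
Proof.
  intros [Hp [Hpu Hu]]; unfold normal, S2, TS2 in *.
  transitivity (vscal (-1) (cross (snd z) (cross (fst z) (snd z)))); [vec_ring | ].
  rewrite cross_cross_l, (dot_comm (snd z) (fst z)), Hpu, Hu; vec_ring.
Qed.

(** HM is identified with SO(3) by the matrices with columns [p], [u], [p x u]; the
   coordinates refer to its left-invariant frame: the two horizontal lifts, of [u] and
   of [p x u], and [vert]. *)
Definition frame_vec (z : vec2) (a b c : R) : vec2 :=
  (vadd (vscal a (snd z)) (vscal b (normal z)),
   vadd (vscal (- a) (fst z)) (vscal c (normal z))).

Lemma frame_dots (z : vec2) (a b c : R) : HM z ->
  dot (fst (frame_vec z a b c)) (fst z) = 0 /\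
  dot (fst (frame_vec z a b c)) (snd z) = a /\
  dot (fst (frame_vec z a b c)) (normal z) = b /\
  dot (snd (frame_vec z a b c)) (fst z) = - a /\
  dot (snd (frame_vec z a b c)) (snd z) = 0 /\
  dot (snd (frame_vec z a b c)) (normal z) = c.
Proof.
  intros H; pose proof (normal_unit z H) as Hn; destruct H as [Hp [Hpu Hu]].
  unfold S2, TS2 in *; cbn [frame_vec fst snd].
  assert (H1 : dot (normal z) (fst z) = 0)
    by (rewrite dot_comm; apply dot_cross_l).
  assert (H2 : dot (normal z) (snd z) = 0)
    by (rewrite dot_comm; apply dot_cross_r).
  rewrite !dot_vadd_l, !dot_vscal_l, Hn, Hu, Hp, Hpu, H1, H2.
  rewrite (dot_comm (snd z) (fst z)), Hpu.
  rewrite (dot_comm (snd z) (normal z)), (dot_comm (fst z) (normal z)), H1, H2.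
  repeat split; ring.
Qed.

Lemma frame_vec_THM (z : vec2) (a b c : R) : HM z -> THM z (frame_vec z a b c).
Proof.
  intros H; destruct (frame_dots z a b c H) as (E1 & E2 & E3 & E4 & E5 & E6).
  unfold THM; rewrite (dot_comm (fst z)), (dot_comm (snd z)), E1, E5, E2.
  rewrite (dot_comm (fst z)), E4; repeat split; ring.
Qed.

Lemma THM_frame_vec (z w : vec2) : HM z -> THM z w ->
  w = frame_vec z (dot (fst w) (snd z)) (dot (fst w) (normal z)) (dot (snd w) (normal z)).
Proof.
  intros H [T1 [T2 T3]].
  pose proof (HM_expand z (fst w) H) as E1; pose proof (HM_expand z (snd w) H) as E2.
  rewrite (dot_comm (fst w) (fst z)), T1 in E1.
  rewrite (dot_comm (snd w) (snd z)), T2 in E2.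
  rewrite (dot_comm (snd w) (fst z)) in E2.
  replace (dot (fst z) (snd w)) with (- dot (fst w) (snd z)) in E2 by lra.
  set (a := dot (fst w) (snd z)) in *; set (b := dot (fst w) (normal z)) in *.
  set (c := dot (snd w) (normal z)) in *; clearbody a b c.
  destruct w as [w1 w2]; cbn [fst snd] in *; unfold frame_vec.
  rewrite E1, E2; f_equal; vec_ring.
Qed.

(** Away from the poles the normalized rotation field is such a direction; at the
   poles, where it vanishes, every horizontal vector is tangent. *)
Lemma HM_inhabited (p : vec) : S2 p -> exists e, HM (p, e).
Proof.
  unfold HM, S2, TS2; cbn [fst snd]; intros Hp.
  destruct (Req_dec (cx p ^ 2 + cy p ^ 2) 0) as [H0 | H0].
  - exists (mkvec 1 0 0); repeat split; trivial;
      unfold dot, mkvec, cx, cy, cz in *; cbn; nra.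
  - set (r := sqrt (cx p ^ 2 + cy p ^ 2)).
    assert (Hr : r * r = cx p ^ 2 + cy p ^ 2) by (apply sqrt_sqrt; nra).
    assert (Hr0 : r <> 0) by nra.
    exists (mkvec (- cy p / r) (cx p / r) 0).
    repeat split; trivial; unfold dot, mkvec, cx, cy, cz in *; cbn [fst snd] in *.
    + field; trivial.
    + transitivity ((fst (fst p) ^ 2 + snd (fst p) ^ 2) / (r * r)); [field; trivial | ].
      rewrite Hr; field; trivial.
Qed.

Lemma fiber_pt_HM (p e : vec) (t : R) : HM (p, e) -> HM (fiber_pt p e t).
Proof.
  intros H; pose proof (normal_unit _ H) as Hn; unfold normal in Hn; cbn [fst snd] in Hn.
  destruct H as [Hp [Hpe He]]; unfold HM, S2, TS2, fiber_pt in *; cbn [fst snd] in *.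
  repeat split; trivial.
  - rewrite dot_vadd_r, !dot_vscal_r, Hpe, dot_cross_l; ring.
  - rewrite dot_vadd_r, !dot_vscal_r, !dot_vadd_l, !dot_vscal_l, He, Hn.
    rewrite dot_cross_r, (dot_comm (cross p e) e), dot_cross_r.
    pose proof (sin2_cos2 t) as E; unfold Rsqr in E; nra.
Qed.

Lemma normal_fiber_pt (p e : vec) (t : R) : HM (p, e) ->
  normal (fiber_pt p e t) = vadd (vscal (- sin t) e) (vscal (cos t) (cross p e)).
Proof.
  intros H; pose proof (cross_fst_normal _ H) as E; unfold normal in *; cbn [fst snd] in *.
  unfold fiber_pt; cbn [fst snd].
  transitivity (vadd (vscal (cos t) (cross p e)) (vscal (sin t) (cross p (cross p e))));
    [vec_ring | rewrite E; vec_ring].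
Qed.

Lemma vscal_1 (a : vec) : vscal 1 a = a.
Proof. vec_ring. Qed.

Lemma vadd_vscal_0 (a b : vec) : vadd a (vscal 0 b) = a.
Proof. vec_ring. Qed.

Lemma polar_coordinates (x y : R) :
  exists r t, 0 <= r /\ 0 <= t <= 2 * PI /\ x = r * cos t /\ y = r * sin t.
Proof.
  pose proof PI_RGT_0 as Hpi.
  set (r := sqrt (x ^ 2 + y ^ 2)).
  assert (Hr2 : r * r = x ^ 2 + y ^ 2) by (apply sqrt_sqrt; nra).
  assert (Hr0 : 0 <= r) by apply sqrt_pos.
  destruct (Req_dec r 0) as [H0 | H0].
  { exists 0, 0; rewrite H0 in Hr2.
    assert (Hx : x = 0) by nra; assert (Hy : y = 0) by (rewrite Hx in Hr2; nra).
    repeat split; lra. }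
  assert (Hx : -1 <= x / r <= 1).
  { assert (E : x = x / r * r) by (field; trivial).
    set (c := x / r) in *; clearbody c.
    assert (Hc : c ^ 2 <= 1) by (apply (Rmult_le_reg_l (r * r)); nra).
    split; nra. }
  pose proof (acos_bound (x / r)) as Hb.
  assert (Hc : r * cos (acos (x / r)) = x) by (rewrite cos_acos by trivial; field; trivial).
  assert (Hs : r * sin (acos (x / r)) = Rabs y).
  { rewrite sin_acos by trivial.
    replace (1 - Rsqr (x / r)) with (y ^ 2 / (r * r)) by
      (unfold Rsqr; replace (y ^ 2) with (r * r - x ^ 2) by lra; field; trivial).
    rewrite sqrt_div_alt by nra; rewrite (sqrt_square r Hr0).
    replace (y ^ 2) with (Rsqr y) by (unfold Rsqr; ring).
    rewrite sqrt_Rsqr_abs; field; trivial. }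
  destruct (Rle_dec 0 y) as [Hy | Hy].
  - exists r, (acos (x / r)); rewrite Hc, Hs, Rabs_pos_eq by trivial.
    repeat split; lra.
  - exists r, (2 * PI - acos (x / r)); rewrite Rabs_left in Hs by lra.
    replace (2 * PI - acos (x / r)) with (- acos (x / r) + 2 * PI) by ring.
    rewrite cos_plus, sin_plus, cos_2PI, sin_2PI, cos_neg, sin_neg.
    repeat split; lra.
Qed.

(** The direction [e] only fixes the origin of the fibre: another choice translates
   the parameter. *)
Lemma fiber_pt_rotate (p e : vec) (a t : R) : HM (p, e) ->
  fiber_pt p (snd (fiber_pt p e a)) t = fiber_pt p e (t + a).
Proof.
  intros H; pose proof (normal_fiber_pt p e a H) as E; unfold normal in E; cbn [fst] in E.
  change (fst (fiber_pt p e a)) with p in E.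
  unfold fiber_pt at 1; rewrite E; unfold fiber_pt; cbn [snd]; rewrite cos_plus, sin_plus.
  generalize (cross p e); intros n; f_equal; vec_ring.
Qed.

Lemma fiber_pt_surjective (p e e' : vec) : HM (p, e) -> HM (p, e') ->
  exists a, e' = snd (fiber_pt p e a).
Proof.
  intros H [_ [H1 H2]]; unfold TS2 in *; cbn [fst snd] in *.
  destruct (polar_coordinates (dot e' e) (dot e' (cross p e))) as (r & a & Hr & _ & E1 & E2).
  pose proof (HM_expand _ e' H) as E; unfold normal in E; cbn [fst snd] in E.
  pose proof (normal_unit _ H) as Hn; unfold normal in Hn; cbn [fst snd] in Hn.
  rewrite (dot_comm e' p), H1, E1, E2 in E.
  assert (Hr2 : r ^ 2 = 1).
  { rewrite E in H2; destruct H as [_ [_ He]]; cbn [snd] in He.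
    revert H2; rewrite !dot_vadd_l, !dot_vadd_r, !dot_vscal_l, !dot_vscal_r, He, Hn.
    rewrite dot_cross_r, (dot_comm (cross p e) e), dot_cross_r.
    pose proof (sin2_cos2 a) as E3; unfold Rsqr in E3; intros K; nra. }
  assert (r = 1) by nra; subst r; exists a; rewrite E; unfold fiber_pt; cbn [snd].
  generalize (cross p e); intros n; vec_ring.
Qed.

Definition some_direction (p : vec) : vec := epsilon (inhabits vzero) (fun e => HM (p, e)).

Lemma some_direction_HM (p : vec) : S2 p -> HM (p, some_direction p).
Proof.
  intros Hp; exact (epsilon_spec (inhabits vzero) (fun e => HM (p, e)) (HM_inhabited p Hp)).
Qed.

(** * Curves of vectors and the Gram-Schmidt retraction *)

Ltac split3 := split; [ | split].

Definition is_vderive (c : R -> vec) (s : R) (v : vec) : Prop :=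
  is_derive (fun r : R => cx (c r)) s (cx v) /\ is_derive (fun r : R => cy (c r)) s (cy v) /\
  is_derive (fun r : R => cz (c r)) s (cz v).

Definition is_vderive2 (c : R -> vec2) (s : R) (w : vec2) : Prop :=
  is_vderive (fun r : R => fst (c r)) s (fst w) /\ is_vderive (fun r : R => snd (c r)) s (snd w).

Lemma is_derive_eq (f : R -> R) (s l l' : R) : is_derive f s l -> l = l' -> is_derive f s l'.
Proof. intros H <-; exact H. Qed.

Lemma is_derive_mult' (f g : R -> R) (s a b : R) :
  is_derive f s a -> is_derive g s b ->
  is_derive (fun r => f r * g r) s (a * g s + f s * b).
Proof. intros Hf Hg; exact (is_derive_mult f g s a b Hf Hg Rmult_comm). Qed.

Lemma is_derive_plus' (f g : R -> R) (s a b : R) :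
  is_derive f s a -> is_derive g s b -> is_derive (fun r => f r + g r) s (a + b).
Proof. exact (is_derive_plus f g s a b). Qed.

Lemma vDerive_unique (c : R -> vec) (s : R) (v : vec) : is_vderive c s v -> vDerive c s = v.
Proof.
  intros (H1 & H2 & H3); apply vec_eq; apply is_derive_unique; assumption.
Qed.

Lemma is_vderive_line (a v : vec) (s : R) : is_vderive (fun r => vadd a (vscal r v)) s v.
Proof.
  unfold is_vderive, vadd, vscal, mkvec, cx, cy, cz; cbn [fst snd].
  split3; auto_derive; trivial; ring.
Qed.

Lemma is_derive_dot (c d : R -> vec) (s : R) (c' d' : vec) :
  is_vderive c s c' -> is_vderive d s d' ->
  is_derive (fun r => dot (c r) (d r)) s (dot c' (d s) + dot (c s) d').
Proof.
  intros (H1 & H2 & H3) (K1 & K2 & K3); unfold dot.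
  eapply is_derive_eq.
  - apply is_derive_plus'; [apply is_derive_plus' | ]; apply is_derive_mult'; eassumption.
  - cbv beta; ring.
Qed.

Lemma is_vderive_vadd (c d : R -> vec) (s : R) (c' d' : vec) :
  is_vderive c s c' -> is_vderive d s d' ->
  is_vderive (fun r => vadd (c r) (d r)) s (vadd c' d').
Proof.
  intros (H1 & H2 & H3) (K1 & K2 & K3).
  unfold is_vderive, vadd, mkvec, cx, cy, cz in *; cbn [fst snd].
  split3; apply is_derive_plus'; assumption.
Qed.

Lemma is_vderive_vscal (k : R -> R) (c : R -> vec) (s k' : R) (c' : vec) :
  is_derive k s k' -> is_vderive c s c' ->
  is_vderive (fun r => vscal (k r) (c r)) s (vadd (vscal k' (c s)) (vscal (k s) c')).
Proof.
  intros Hk (H1 & H2 & H3).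
  unfold is_vderive, vadd, vscal, mkvec, cx, cy, cz in *; cbn [fst snd].
  split3; apply is_derive_mult'; assumption.
Qed.

Lemma is_vderive_cross (c d : R -> vec) (s : R) (c' d' : vec) :
  is_vderive c s c' -> is_vderive d s d' ->
  is_vderive (fun r => cross (c r) (d r)) s (vadd (cross c' (d s)) (cross (c s) d')).
Proof.
  intros (H1 & H2 & H3) (K1 & K2 & K3).
  unfold is_vderive, cross, vadd, mkvec, cx, cy, cz in *; cbn [fst snd].
  split3; (eapply is_derive_eq;
    [apply @is_derive_minus; apply is_derive_mult'; eassumption
    | unfold minus, plus, opp; cbn; ring]).
Qed.

Lemma is_derive_inv_norm (c : R -> vec) (s : R) (c' : vec) :
  is_vderive c s c' -> 0 < dot (c s) (c s) ->
  is_derive (fun r => / sqrt (dot (c r) (c r))) s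
    (- dot (c s) c' / (dot (c s) (c s) * sqrt (dot (c s) (c s)))).
Proof.
  intros Hc H0; pose proof (is_derive_dot c c s c' c' Hc Hc) as Hd; cbv beta in Hd.
  set (h := fun r => dot (c r) (c r)) in *.
  change (dot (c s) (c s)) with (h s) in *.
  pose proof (sqrt_lt_R0 _ H0) as Hr; pose proof (sqrt_sqrt (h s) (Rlt_le _ _ H0)) as Hrr.
  apply (is_derive_eq _ _ (- ((dot c' (c s) + dot (c s) c') / (2 * sqrt (h s))) / sqrt (h s) ^ 2)).
  - apply (is_derive_inv (fun r => sqrt (h r))); [ | lra].
    exact (is_derive_sqrt h s _ Hd H0).
  - rewrite (dot_comm c'); rewrite <- Hrr at 3; field; lra.
Qed.

Lemma is_vderive_normalize (c : R -> vec) (s : R) (c' : vec) :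
  is_vderive c s c' -> 0 < dot (c s) (c s) ->
  is_vderive (fun r => vnormalize (c r)) s
    (vscal (/ sqrt (dot (c s) (c s)))
      (vadd c' (vscal (- dot c' (vnormalize (c s))) (vnormalize (c s))))).
Proof.
  intros Hc H0; unfold vnormalize.
  pose proof (sqrt_lt_R0 _ H0) as Hr.
  pose proof (sqrt_sqrt (dot (c s) (c s)) (Rlt_le _ _ H0)) as Hrr.
  pose proof (is_vderive_vscal _ _ _ _ _ (is_derive_inv_norm c s c' Hc H0) Hc) as H.
  cbv beta in H.
  replace (vscal (/ sqrt (dot (c s) (c s))) _) with
    (vadd (vscal (- dot (c s) c' / (dot (c s) (c s) * sqrt (dot (c s) (c s)))) (c s))
          (vscal (/ sqrt (dot (c s) (c s))) c')); [exact H | ].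
  rewrite dot_vscal_r, (dot_comm c').
  rewrite <- Hrr at 1; set (n := sqrt (dot (c s) (c s))) in *; set (m := dot (c s) c').
  clearbody n m; clear H; destruct (c s) as [[? ?] ?], c' as [[? ?] ?].
  unfold vadd, vscal, mkvec, cx, cy, cz; cbn [fst snd]; pair_eq; field; lra.
Qed.

Lemma vnormalize_unit (a : vec) : 0 < dot a a -> dot (vnormalize a) (vnormalize a) = 1.
Proof.
  intros H; unfold vnormalize; rewrite dot_vscal_l, dot_vscal_r.
  pose proof (sqrt_lt_R0 _ H) as Hr; rewrite <- (sqrt_sqrt _ (Rlt_le _ _ H)) at 3.
  field; lra.
Qed.

Lemma vnormalize_id (a : vec) : dot a a = 1 -> vnormalize a = a.
Proof.
  intros H; unfold vnormalize; rewrite H, sqrt_1.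
  destruct a as [[? ?] ?]; unfold vscal, mkvec, cx, cy, cz; cbn; pair_eq; field.
Qed.

Lemma dot_vnormalize (a b : vec) : dot a (vnormalize b) = dot a b / sqrt (dot b b).
Proof. unfold vnormalize; rewrite dot_vscal_r; unfold Rdiv; ring. Qed.

Definition line (z w : vec2) (s : R) : vec2 := vadd2 z (vscal2 s w).
Definition retr_curve (z w : vec2) (s : R) : vec2 := retr (line z w s).

Lemma line_fst_norm (z w : vec2) (s : R) : HM z -> THM z w ->
  dot (fst (line z w s)) (fst (line z w s)) = 1 + s ^ 2 * dot (fst w) (fst w).
Proof.
  intros [H1 [H2 H3]] [T1 [T2 T3]]; unfold S2 in H1; unfold line, vadd2, vscal2; cbn [fst snd].
  rewrite !dot_vadd_l, !dot_vadd_r, !dot_vscal_l, !dot_vscal_r, H1, (dot_comm (fst w)), T1; ring.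
Qed.

Lemma line_fst_pos (z w : vec2) (s : R) : HM z -> THM z w ->
  0 < dot (fst (line z w s)) (fst (line z w s)).
Proof.
  intros Hz Hw; rewrite line_fst_norm by trivial.
  pose proof (dot_self_ge0 (fst w)); nra.
Qed.

(** The vector that [retr] normalizes in its second component. *)
Definition gram (x : vec2) : vec :=
  vadd (snd x) (vscal (- dot (snd x) (vnormalize (fst x))) (vnormalize (fst x))).

(** A line tangent to HM stays among the linearly independent pairs: by
   Cauchy-Schwarz the Gram determinant of its points is at least one. *)
Lemma gram_line_pos (z w : vec2) (s : R) : HM z -> THM z w ->
  0 < dot (gram (line z w s)) (gram (line z w s)).
Proof.
  intros Hz Hw; pose proof (line_fst_norm z w s Hz Hw) as En.
  pose proof (line_fst_pos z w s Hz Hw) as Hpos.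
  set (x := line z w s) in *; unfold gram.
  pose proof (vnormalize_unit (fst x) Hpos) as Eu.
  rewrite !dot_vadd_l, !dot_vadd_r, !dot_vscal_l, !dot_vscal_r, Eu.
  rewrite (dot_comm (vnormalize (fst x)) (snd x)), dot_vnormalize.
  pose proof (sqrt_lt_R0 _ Hpos) as Hr; pose proof (sqrt_sqrt _ (Rlt_le _ _ Hpos)) as Hrr.
  set (r := sqrt (dot (fst x) (fst x))) in *.
  replace (_ + _) with ((dot (snd x) (snd x) * (r * r) - dot (snd x) (fst x) ^ 2) / (r * r))
    by (field; lra).
  apply Rdiv_lt_0_compat; [ | nra].
  destruct Hz as [H1 [H2 H3]], Hw as [T1 [T2 T3]]; unfold S2, TS2 in *.
  rewrite Hrr, En.
  unfold x, line, vadd2, vscal2; cbn [fst snd].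
  rewrite !dot_vadd_l, !dot_vadd_r, !dot_vscal_l, !dot_vscal_r.
  rewrite (dot_comm (snd w) (snd z)), T2, H3, (dot_comm (snd z) (fst z)), H2.
  rewrite (dot_comm (snd z) (fst w)), (dot_comm (snd w) (fst z)).
  replace (dot (fst z) (snd w)) with (- dot (fst w) (snd z)) by lra.
  rewrite (dot_comm (snd w) (fst w)).
  pose proof (dot_cross_self (fst w) (snd w)) as CS.
  pose proof (dot_self_ge0 (cross (fst w) (snd w))) as CS0.
  pose proof (dot_self_ge0 (fst w)); pose proof (dot_self_ge0 (snd w)).
  set (A := dot (fst w) (fst w)) in *; set (B := dot (snd w) (snd w)) in *.
  set (C := dot (fst w) (snd w)) in *.
  replace (_ - _) with (1 + s ^ 2 * A + s ^ 2 * B + s ^ 4 * (A * B - C ^ 2)) by ring.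
  assert (0 <= s ^ 4 * (A * B - C ^ 2))
    by (apply Rmult_le_pos; [replace (s ^ 4) with ((s ^ 2) ^ 2) by ring; apply pow2_ge_0 | lra]).
  nra.
Qed.

Lemma retr_curve_HM (z w : vec2) (s : R) : HM z -> THM z w -> HM (retr_curve z w s).
Proof.
  intros Hz Hw; pose proof (line_fst_pos z w s Hz Hw) as H1.
  pose proof (gram_line_pos z w s Hz Hw) as H2.
  unfold retr_curve, retr, HM, S2, TS2; cbn [fst snd].
  split; [apply vnormalize_unit, H1 | split; [ | apply vnormalize_unit, H2]].
  fold (gram (line z w s)); rewrite dot_vnormalize; unfold gram at 1.
  rewrite dot_vadd_r, dot_vscal_r, (vnormalize_unit _ H1), (dot_comm (vnormalize _)).
  unfold Rdiv; ring.
Qed.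

Lemma line_0 (z w : vec2) : line z w 0 = z.
Proof.
  unfold line, vadd2, vscal2; cbn [fst snd]; rewrite !vadd_vscal_0.
  symmetry; apply surjective_pairing.
Qed.

Lemma retr_curve_0 (z w : vec2) : HM z -> retr_curve z w 0 = z.
Proof.
  intros [H1 [H2 H3]]; unfold S2, TS2 in *; unfold retr_curve; rewrite line_0.
  unfold retr; rewrite (vnormalize_id (fst z) H1), (dot_comm (snd z)), H2.
  rewrite Ropp_0, vadd_vscal_0, vnormalize_id by exact H3.
  symmetry; apply surjective_pairing.
Qed.

Lemma is_vderive_fst_retr (x w : vec2) (s : R) :
  0 < dot (fst (line x w s)) (fst (line x w s)) ->
  is_vderive (fun r => fst (retr_curve x w r)) s
    (vscal (/ sqrt (dot (fst (line x w s)) (fst (line x w s))))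
       (vadd (fst w) (vscal (- dot (fst w) (fst (retr_curve x w s))) (fst (retr_curve x w s))))).
Proof.
  intros H; unfold retr_curve, retr; cbn [fst].
  apply (is_vderive_normalize (fun r => fst (line x w r))); [ | exact H].
  apply is_vderive_line.
Qed.

(** The first-order terms that Gram-Schmidt removes are the left-hand sides of the
   equations of [THM], hence zero. So a derivative taken through [retr] at a point of
   HM is a derivative along a curve in HM. *)
Lemma is_vderive_retr_curve (z w : vec2) : HM z -> THM z w ->
  is_vderive2 (retr_curve z w) 0 w.
Proof.
  intros Hz Hw.
  pose proof (is_vderive_fst_retr z w 0 (line_fst_pos z w 0 Hz Hw)) as D1.
  rewrite (line_fst_norm z w 0 Hz Hw) in D1.
  rewrite (retr_curve_0 z w Hz) in D1.
  pose proof (gram_line_pos z w 0 Hz Hw) as Hg.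
  assert (Z : retr_curve z w 0 = z) by (apply retr_curve_0; trivial).
  destruct Hz as [H1 [H2 H3]], Hw as [T1 [T2 T3]]; unfold S2, TS2 in *.
  rewrite (dot_comm (fst w) (fst z)), T1 in D1.
  replace (1 + 0 ^ 2 * dot (fst w) (fst w)) with 1 in D1 by ring; rewrite sqrt_1 in D1.
  rewrite Ropp_0, vadd_vscal_0, Rinv_1, vscal_1 in D1.
  split; [exact D1 | ].
  assert (L0 : snd (line z w 0) = snd z)
    by apply vadd_vscal_0.
  assert (N0 : vnormalize (fst (line z w 0)) = fst z) by exact (f_equal fst Z).
  assert (D2 : is_vderive (fun r => gram (line z w r)) 0 (snd w)).
  { assert (DL : is_vderive (fun r => snd (line z w r)) 0 (snd w)) by apply is_vderive_line.
    pose proof (is_derive_dot _ _ _ _ _ DL D1) as Dd; cbv beta in Dd.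
    assert (Dd' : is_derive (fun r => - dot (snd (line z w r)) (fst (retr_curve z w r))) 0 0).
    { eapply is_derive_eq; [apply @is_derive_opp; exact Dd | ].
      rewrite L0, Z, (dot_comm (snd w)), (dot_comm (snd z)).
      unfold opp; cbn; lra. }
    pose proof (is_vderive_vadd _ _ _ _ _ DL (is_vderive_vscal _ _ _ _ _ Dd' D1)) as D.
    cbv beta in D; rewrite L0, Z, (dot_comm (snd z)), H2, Ropp_0, !vadd_vscal_0 in D.
    exact D. }
  assert (G0 : gram (line z w 0) = snd z).
  { unfold gram; rewrite L0, N0, (dot_comm (snd z)), H2, Ropp_0; apply vadd_vscal_0. }
  pose proof (is_vderive_normalize _ _ _ D2 Hg) as D; cbv beta in D.
  rewrite G0, (vnormalize_id (snd z) H3), (dot_comm (snd w)), T2, H3, sqrt_1 in D.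
  rewrite Ropp_0, vadd_vscal_0, Rinv_1, vscal_1 in D; exact D.
Qed.

(** * The chain rule for smooth functions on space *)

Ltac real_ring := match goal with |- @eq _ ?a ?b => change (@eq R a b) end; ring.

(** As [n] vanishes at [s], the difference quotient of the product is [m] times that
   of [n], and continuity of [m] suffices. *)
Lemma is_derive_vanishing_mult (m n : R -> R) (s n' : R) :
  continuous m s -> n s = 0 -> is_derive n s n' ->
  is_derive (fun r => m r * n r) s (m s * n').
Proof.
  intros Hm Hn Dn; apply is_derive_Reals; apply is_derive_Reals in Dn.
  assert (Lm : limit1_in (fun h => m (s + h)) (fun h => h <> 0) (m s) 0).
  { intros e He; apply continuity_pt_filterlim in Hm.
    destruct (Hm e He) as (d & Hd & K); exists d; split; [exact Hd | ].
    intros h [Hh0 Hh]; apply K; split.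
    - split; [exact I | lra].
    - cbn in *; unfold Rdist in *; replace (s + h - s) with (h - 0) by ring; exact Hh. }
  assert (Ln : limit1_in (fun h => (n (s + h) - n s) / h) (fun h => h <> 0) n' 0).
  { intros e He; destruct (Dn e He) as (d & K); exists d; split; [apply cond_pos | ].
    intros h [Hh0 Hh]; apply K; [exact Hh0 | ].
    cbn in Hh; unfold Rdist in Hh; rewrite Rminus_0_r in Hh; exact Hh. }
  pose proof (limit_mul _ _ _ _ _ _ Lm Ln) as L.
  intros e He; destruct (L e He) as (d & Hd & K); exists (mkposreal d Hd).
  intros h Hh0 Hh; specialize (K h); cbn in K, Hh; unfold Rdist in K.
  rewrite Hn in *; replace ((_ - _) / h) with (m (s + h) * ((n (s + h) - 0) / h)) by (field; exact Hh0).
  apply K; split; [exact Hh0 | rewrite Rminus_0_r; exact Hh].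
Qed.

(** By the mean value theorem in the first variable the increment is a partial
   derivative at an intermediate point, continuous at [s], times the increment of [x]. *)
Lemma is_derive_first_increment {T : UniformSpace} (G G1 : R -> T -> R)
    (x : R -> R) (y : R -> T) (s x' : R) :
  (forall a b, is_derive (fun r => G r b) a (G1 a b)) ->
  continuous (fun q : R * T => G1 (fst q) (snd q)) (x s, y s) ->
  is_derive x s x' -> continuous y s ->
  is_derive (fun r => G (x r) (y r) - G (x s) (y r)) s (G1 (x s) (y s) * x').
Proof.
  intros DG CG1 Dx Cy.
  assert (MV : forall r, exists m, Rmin (x s) (x r) <= m <= Rmax (x s) (x r) /\
    G (x r) (y r) - G (x s) (y r) = G1 m (y r) * (x r - x s)).
  { intros r; apply (MVT_gen (fun t => G t (y r)) (x s) (x r) (fun t => G1 t (y r))).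
    - intros t _; apply DG.
    - intros t _; apply continuity_pt_filterlim, @ex_derive_continuous.
      exists (G1 t (y r)); apply DG. }
  set (m := fun r => proj1_sig (constructive_indefinite_description _ (MV r))).
  assert (Hm : forall r, Rmin (x s) (x r) <= m r <= Rmax (x s) (x r) /\
    G (x r) (y r) - G (x s) (y r) = G1 (m r) (y r) * (x r - x s))
    by (intros r; exact (proj2_sig (constructive_indefinite_description _ (MV r)))).
  clearbody m.
  assert (ms : m s = x s).
  { destruct (Hm s) as [B _]; rewrite Rmin_left, Rmax_left in B by lra; lra. }
  apply (is_derive_ext (fun r => G1 (m r) (y r) * (x r - x s))).
  { intros r; symmetry; apply Hm. }
  replace (G1 (x s) (y s)) with (G1 (m s) (y s)) by (rewrite ms; reflexivity).
  apply (is_derive_vanishing_mult (fun r => G1 (m r) (y r)) (fun r => x r - x s)).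
  - apply filterlim_locally; intros e; rewrite ms.
    pose proof (proj1 (filterlim_locally _ _) CG1 e) as [d Hd]; cbn [fst snd] in Hd.
    assert (Cx : continuous x s) by (apply @ex_derive_continuous; exists x'; exact Dx).
    pose proof (proj1 (filterlim_locally _ _) Cx d) as Lx.
    pose proof (proj1 (filterlim_locally _ _) Cy d) as Ly.
    generalize (filter_and _ _ Lx Ly); apply filter_imp; intros r [Bx By].
    apply (Hd (m r, y r)); split; [ | exact By]; cbn.
    revert Bx; unfold ball; cbn; unfold AbsRing_ball, abs, minus, plus, opp; cbn.
    destruct (Hm r) as [B _]; revert B.
    unfold Rmin, Rmax, Rabs; repeat destruct Rle_dec; repeat destruct Rcase_abs; lra.
  - ring.
  - eapply is_derive_eq; [apply (is_derive_minus x (fun _ => x s)); [exact Dx | apply is_derive_const] | ].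
    unfold minus, plus, opp, zero; cbn; ring.
Qed.

Definition dirD (v : vec) (g : vec -> R) (x : vec) : R :=
  Derive (fun s => g (vadd x (vscal s v))) 0.

Definition smooth (g : vec -> R) : Prop := forall k, Ck k g.

Lemma smooth_dirD (v : vec) (g : vec -> R) : smooth g -> smooth (dirD v g).
Proof. intros H k; exact (proj2 (proj2 (H (S k)) v)). Qed.

Lemma smooth_continuous (g : vec -> R) (x : vec) : smooth g -> continuous g x.
Proof. intros H; exact (proj1 (H O) x). Qed.

Lemma smooth_is_derive_line (v : vec) (g : vec -> R) (x : vec) : smooth g ->
  is_derive (fun s => g (vadd x (vscal s v))) 0 (dirD v g x).
Proof. intros H; apply Derive_correct; exact (proj1 (proj2 (H 1%nat) v) x). Qed.

Lemma smooth_is_derive_shifted (v : vec) (g : vec -> R) (x : vec) (t : R) (h : R -> vec) :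
  smooth g -> (forall s, h s = vadd x (vscal (s - t) v)) ->
  is_derive (fun s => g (h s)) t (dirD v g x).
Proof.
  intros Hg Hh; apply (is_derive_ext (fun s => g (vadd x (vscal (s - t) v)))).
  { intros s; rewrite Hh; reflexivity. }
  eapply is_derive_eq.
  - apply (is_derive_comp (fun r => g (vadd x (vscal r v))) (fun s => s - t)).
    + rewrite Rminus_diag; apply smooth_is_derive_line, Hg.
    + auto_derive; trivial.
  - unfold scal; cbn; unfold mult; cbn; ring.
Qed.

Lemma smooth_partials (g : vec -> R) (a b d : R) : smooth g ->
  is_derive (fun t : R => g (t, b, d)) a (dirD (mkvec 1 0 0) g (a, b, d)) /\
  is_derive (fun t : R => g (a, t, d)) b (dirD (mkvec 0 1 0) g (a, b, d)) /\
  is_derive (fun t : R => g (a, b, t)) d (dirD (mkvec 0 0 1) g (a, b, d)).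
Proof.
  intros Hg; split3; (apply smooth_is_derive_shifted; [exact Hg | intros r]);
    unfold vadd, vscal, mkvec, cx, cy, cz; cbn; pair_eq; ring.
Qed.

(** Continuity of the partial derivatives allows the coordinates of the curve to be
   moved one at a time. *)
Lemma smooth_chain_basis (g : vec -> R) (c : R -> vec) (s : R) (v : vec) :
  smooth g -> is_vderive c s v ->
  is_derive (fun r => g (c r)) s
    (cx v * dirD (mkvec 1 0 0) g (c s) + cy v * dirD (mkvec 0 1 0) g (c s)
     + cz v * dirD (mkvec 0 0 1) g (c s)).
Proof.
  intros Hg (D1 & D2 & D3).
  set (x := fun r => cx (c r)) in *; set (y := fun r => cy (c r)) in *.
  set (z := fun r => cz (c r)) in *.
  assert (Ec : forall r, c r = (x r, y r, z r)) by (intros r; apply vec_eq; reflexivity).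
  assert (Cx : continuous x s) by (apply @ex_derive_continuous; eexists; exact D1).
  assert (Cy : continuous y s) by (apply @ex_derive_continuous; eexists; exact D2).
  assert (Cz : continuous z s) by (apply @ex_derive_continuous; eexists; exact D3).
  assert (I1 := is_derive_first_increment
    (fun a (b : R * R) => g (a, fst b, snd b))
    (fun a (b : R * R) => dirD (mkvec 1 0 0) g (a, fst b, snd b)) x (fun r => (y r, z r)) s (cx v)).
  assert (I2 := is_derive_first_increment (fun a (b : R) => g (x s, a, b))
    (fun a (b : R) => dirD (mkvec 0 1 0) g (x s, a, b)) y z s (cy v)).
  assert (I3 := is_derive_first_increment (fun a (b : R) => g (x s, y s, a))
    (fun a (b : R) => dirD (mkvec 0 0 1) g (x s, y s, a)) z (fun _ => 0) s (cz v)).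
  cbn [fst snd] in I1, I2, I3.
  apply (is_derive_ext (fun r =>
    g (c s) + ((g (x r, y r, z r) - g (x s, y r, z r))
    + (g (x s, y r, z r) - g (x s, y s, z r)) + (g (x s, y s, z r) - g (x s, y s, z s))))).
  { intros r; rewrite !Ec; real_ring. }
  rewrite !(Ec s); eapply is_derive_eq.
  - apply is_derive_plus'; [apply @is_derive_const | ].
    apply is_derive_plus'; [apply is_derive_plus' | ].
    + apply I1; trivial.
      * intros a b; apply (smooth_partials g a (fst b) (snd b) Hg).
      * apply filterlim_locally; intros e.
        pose proof (smooth_continuous _ (x s, y s, z s) (smooth_dirD (mkvec 1 0 0) g Hg)) as K.
        destruct (proj1 (filterlim_locally _ _) K e) as [d Hd].
        exists d; intros [a [b1 b2]] [Ba [Bb1 Bb2]]; apply Hd; repeat split; assumption.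
      * apply filterlim_locally; intros e.
        pose proof (proj1 (filterlim_locally _ _) Cy e) as Ly.
        pose proof (proj1 (filterlim_locally _ _) Cz e) as Lz.
        generalize (filter_and _ _ Ly Lz); apply filter_imp; intros r [By Bz]; split; assumption.
    + apply I2; trivial.
      * intros a b; apply (smooth_partials g (x s) a b Hg).
      * apply filterlim_locally; intros e.
        pose proof (smooth_continuous _ (x s, y s, z s) (smooth_dirD (mkvec 0 1 0) g Hg)) as K.
        destruct (proj1 (filterlim_locally _ _) K e) as [d Hd].
        exists d; intros [a b] [Ba Bb]; apply Hd; repeat split; try assumption; apply ball_center.
    + apply I3; trivial.
      * intros a b; apply (smooth_partials g (x s) (y s) a Hg).
      * apply filterlim_locally; intros e.
        pose proof (smooth_continuous _ (x s, y s, z s) (smooth_dirD (mkvec 0 0 1) g Hg)) as K.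
        destruct (proj1 (filterlim_locally _ _) K e) as [d Hd].
        exists d; intros [a b] [Ba Bb]; apply Hd; repeat split; try assumption; apply ball_center.
      * apply continuous_const.
  - unfold zero; cbn; ring.
Qed.

Lemma dirD_basis (g : vec -> R) (v x : vec) : smooth g ->
  dirD v g x = cx v * dirD (mkvec 1 0 0) g x + cy v * dirD (mkvec 0 1 0) g x
               + cz v * dirD (mkvec 0 0 1) g x.
Proof.
  intros Hg; apply is_derive_unique.
  pose proof (smooth_chain_basis g _ 0 v Hg (is_vderive_line x v 0)) as D.
  cbv beta in D; rewrite vadd_vscal_0 in D; exact D.
Qed.

Lemma smooth_chain (g : vec -> R) (c : R -> vec) (s : R) (v : vec) :
  smooth g -> is_vderive c s v -> is_derive (fun r => g (c r)) s (dirD v g (c s)).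
Proof. intros Hg Dc; rewrite dirD_basis by exact Hg; apply smooth_chain_basis; assumption. Qed.

Lemma dirD_linear (g : vec -> R) (a b : R) (v w x : vec) : smooth g ->
  dirD (vadd (vscal a v) (vscal b w)) g x = a * dirD v g x + b * dirD w g x.
Proof.
  intros Hg; rewrite (dirD_basis g (vadd _ _)), (dirD_basis g v), (dirD_basis g w) by exact Hg.
  unfold vadd, vscal, mkvec, cx, cy, cz; cbn; ring.
Qed.

(** The directions are kept constant: this is the second derivative in space, not the
   Hessian of the sphere. *)
Definition hess (g : vec -> R) (x v w : vec) : R := dirD w (dirD v g) x.

Lemma dirD_vscal (g : vec -> R) (a : R) (v x : vec) : smooth g ->
  dirD (vscal a v) g x = a * dirD v g x.
Proof.
  intros Hg; rewrite (dirD_basis g (vscal _ _)), (dirD_basis g v) by exact Hg.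
  unfold vscal, mkvec, cx, cy, cz; cbn; ring.
Qed.

Lemma hess_linear (g : vec -> R) (a b : R) (v w u x : vec) : smooth g ->
  hess g x (vadd (vscal a v) (vscal b w)) u = a * hess g x v u + b * hess g x w u.
Proof.
  intros Hg; apply is_derive_unique.
  apply (is_derive_ext (fun s => a * dirD v g (vadd x (vscal s u))
                               + b * dirD w g (vadd x (vscal s u)))).
  - intros s; symmetry; apply dirD_linear, Hg.
  - apply is_derive_plus'; apply (is_derive_scal (fun s => dirD _ g (vadd x (vscal s u))));
      apply smooth_is_derive_line, smooth_dirD, Hg.
Qed.

Lemma hess_vscal (g : vec -> R) (a : R) (v u x : vec) : smooth g ->
  hess g x (vscal a v) u = a * hess g x v u.
Proof.
  intros Hg; replace (vscal a v) with (vadd (vscal a v) (vscal 0 v)) by apply vadd_vscal_0.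
  rewrite hess_linear by exact Hg; ring.
Qed.

(** When [d] is the velocity of [c], this splits the second derivative of [g] along [c]
   into the contributions of the acceleration and of the velocity. *)
Lemma smooth_chain_dirD (g : vec -> R) (c d : R -> vec) (s : R) (v w : vec) :
  smooth g -> is_vderive c s v -> is_vderive d s w ->
  is_derive (fun r => dirD (d r) g (c r)) s (dirD w g (c s) + hess g (c s) (d s) v).
Proof.
  intros Hg Dc Dd; pose proof Dd as (D1 & D2 & D3).
  apply (is_derive_ext (fun r => cx (d r) * dirD (mkvec 1 0 0) g (c r)
    + cy (d r) * dirD (mkvec 0 1 0) g (c r) + cz (d r) * dirD (mkvec 0 0 1) g (c r))).
  { intros r; symmetry; apply dirD_basis, Hg. }
  assert (C : forall e, is_derive (fun r => dirD e g (c r)) s (hess g (c s) e v))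
    by (intros e; apply smooth_chain; [apply smooth_dirD, Hg | exact Dc]).
  eapply is_derive_eq.
  - exact (is_derive_plus' _ _ _ _ _
      (is_derive_plus' _ _ _ _ _ (is_derive_mult' _ _ _ _ _ D1 (C (mkvec 1 0 0)))
                                 (is_derive_mult' _ _ _ _ _ D2 (C (mkvec 0 1 0))))
      (is_derive_mult' _ _ _ _ _ D3 (C (mkvec 0 0 1)))).
  - cbv beta; rewrite (dirD_basis g w) by exact Hg.
    assert (E : d s = vadd (vscal 1 (vadd (vscal (cx (d s)) (mkvec 1 0 0))
      (vscal (cy (d s)) (mkvec 0 1 0)))) (vscal (cz (d s)) (mkvec 0 0 1)))
      by (generalize (d s); clear; vec_ring).
    replace (hess g (c s) (d s) v) with (cx (d s) * hess g (c s) (mkvec 1 0 0) v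
      + cy (d s) * hess g (c s) (mkvec 0 1 0) v + cz (d s) * hess g (c s) (mkvec 0 0 1) v)
      by (rewrite E at 4; rewrite !hess_linear by exact Hg; ring).
    ring.
Qed.

(** * Spherical coordinates *)

(** The longitude of a pole is free, and is chosen so that the tangent vector lies on
   the meridian. *)
Lemma sph_surjective (p v : vec) : S2 p -> TS2 p v ->
  exists phi theta xi_phi xi_theta,
    0 <= phi <= PI /\ 0 <= theta <= 2 * PI /\ p = sph phi theta /\
    v = vadd (vscal xi_phi (sph_phi phi theta)) (vscal xi_theta (sph_theta phi theta)).
Proof.
  destruct p as [[x y] z], v as [[v1 v2] v3].
  unfold S2, TS2, sph, sph_phi, sph_theta, vadd, vscal, dot, mkvec, cx, cy, cz.
  cbn [fst snd]; intros Hp Hv.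
  assert (Hz : -1 <= z <= 1) by (split; nra).
  set (phi := acos z).
  assert (Hphi : 0 <= phi <= PI) by apply acos_bound.
  assert (Hcos : cos phi = z) by (apply cos_acos; trivial).
  assert (Hsin : 0 <= sin phi) by (apply sin_ge_0; lra).
  pose proof (sin2_cos2 phi) as Hsc; unfold Rsqr in Hsc; rewrite Hcos in Hsc.
  destruct (Req_dec (sin phi) 0) as [H0 | H0].
  - assert (Hz1 : z * z = 1) by (rewrite H0 in Hsc; lra).
    assert (x = 0) by (apply Rsqr_0_uniq; unfold Rsqr; nra).
    assert (y = 0) by (apply Rsqr_0_uniq; unfold Rsqr; nra).
    subst x y; assert (v3 = 0) by (replace v3 with (z * z * v3) by (rewrite Hz1; ring); nra).
    subst v3.
    destruct (polar_coordinates v1 v2) as (r & t & Hr & Ht & E1 & E2).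
    exists phi, t, (z * r), 0; rewrite Hcos, H0, E1, E2.
    split; [exact Hphi | split; [exact Ht | split]];
      pair_eq; try ring.
    + rewrite <- (Rmult_1_l (r * cos t)), <- Hz1; ring.
    + rewrite <- (Rmult_1_l (r * sin t)), <- Hz1; ring.
  - destruct (polar_coordinates x y) as (r & t & Hr & Ht & E1 & E2).
    pose proof (sin2_cos2 t) as Ht2; unfold Rsqr in Ht2.
    assert (Hrs : r = sin phi) by nra.
    subst r; exists phi, t, (z * (v1 * cos t + v2 * sin t) - sin phi * v3),
      ((v2 * cos t - v1 * sin t) / sin phi).
    rewrite Hcos; split; [exact Hphi | split; [exact Ht | split]].
    + pair_eq; trivial.
    + assert (Hv' : sin phi * (v1 * cos t + v2 * sin t) = - (z * v3)) by nra.
      set (A := v1 * cos t + v2 * sin t) in *.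
      assert (HA : z * (z * A - sin phi * v3) = A) by
        (replace (z * (z * A - sin phi * v3)) with ((z * z) * A - sin phi * (z * v3)) by ring;
         replace (z * v3) with (- (sin phi * A)) by lra;
         transitivity ((sin phi * sin phi + z * z) * A); [ring | rewrite Hsc; ring]).
      pair_eq.
      * transitivity (A * cos t - (v2 * cos t - v1 * sin t) * sin t);
          [ | rewrite <- HA at 1; field; trivial].
        transitivity (v1 * (sin t * sin t + cos t * cos t)); [rewrite Ht2 | unfold A]; ring.
      * transitivity (A * sin t + (v2 * cos t - v1 * sin t) * cos t);
          [ | rewrite <- HA at 1; field; trivial].
        transitivity (v2 * (sin t * sin t + cos t * cos t)); [rewrite Ht2 | unfold A]; ring.
      * transitivity ((sin phi * sin phi + z * z) * v3 - z * (sin phi * A + z * v3));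
          [rewrite Hv', Hsc; ring | ring].
Qed.


Definition sph_unit_theta (theta : R) : vec := mkvec (- sin theta) (cos theta) 0.

Lemma sph_HM (phi theta : R) : HM (sph phi theta, sph_phi phi theta).
Proof.
  pose proof (sin2_cos2 phi) as E1; pose proof (sin2_cos2 theta) as E2; unfold Rsqr in *.
  unfold HM, S2, TS2, sph, sph_phi, dot, mkvec, cx, cy, cz; cbn [fst snd]; split3.
  - transitivity (sin phi * sin phi * (sin theta * sin theta + cos theta * cos theta)
      + cos phi * cos phi); [ring | rewrite E2; lra].
  - transitivity (sin phi * cos phi * (sin theta * sin theta + cos theta * cos theta - 1));
      [ring | rewrite E2; ring].
  - transitivity (cos phi * cos phi * (sin theta * sin theta + cos theta * cos theta)
      + sin phi * sin phi); [ring | rewrite E2; lra].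
Qed.

Lemma normal_sph (phi theta : R) :
  normal (sph phi theta, sph_phi phi theta) = sph_unit_theta theta.
Proof.
  pose proof (sin2_cos2 phi) as E1; unfold Rsqr in *.
  unfold normal, cross, sph, sph_phi, sph_unit_theta, mkvec, cx, cy, cz; cbn [fst snd]; pair_eq.
  - transitivity (- ((sin phi * sin phi + cos phi * cos phi) * sin theta)); [ring | rewrite E1; ring].
  - transitivity ((sin phi * sin phi + cos phi * cos phi) * cos theta); [ring | rewrite E1; ring].
  - ring.
Qed.

Lemma is_vderive_sph_phi (phi theta : R) :
  is_vderive (fun t => sph t theta) phi (sph_phi phi theta).
Proof.
  unfold is_vderive, sph, sph_phi, mkvec, cx, cy, cz; cbn [fst snd].
  split3; auto_derive; trivial; ring.
Qed.

Lemma is_vderive_sph_phi_phi (phi theta : R) :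
  is_vderive (fun t => sph_phi t theta) phi (vscal (-1) (sph phi theta)).
Proof.
  unfold is_vderive, vscal, sph, sph_phi, mkvec, cx, cy, cz; cbn [fst snd].
  split3; auto_derive; trivial; ring.
Qed.

Lemma is_vderive_sph_theta (phi theta : R) :
  is_vderive (fun t => sph phi t) theta (vscal (sin phi) (sph_unit_theta theta)).
Proof.
  unfold is_vderive, vscal, sph, sph_unit_theta, mkvec, cx, cy, cz; cbn [fst snd].
  split3; auto_derive; trivial; ring.
Qed.

Lemma is_vderive_sph_theta_theta (phi theta : R) :
  is_vderive (fun t => vscal (sin phi) (sph_unit_theta t)) theta
    (vadd (vscal (- sin phi ^ 2) (sph phi theta))
          (vscal (- (sin phi * cos phi)) (sph_phi phi theta))).
Proof.
  pose proof (sin2_cos2 phi) as E1; unfold Rsqr in *.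
  unfold is_vderive, vadd, vscal, sph, sph_phi, sph_unit_theta, mkvec, cx, cy, cz; cbn [fst snd].
  split3; auto_derive; trivial.
  - transitivity (- (sin phi * cos theta) * (sin phi * sin phi + cos phi * cos phi));
      [rewrite E1; ring | ring].
  - transitivity (- (sin phi * sin theta) * (sin phi * sin phi + cos phi * cos phi));
      [rewrite E1; ring | ring].
  - ring.
Qed.

Lemma S2_sph (phi theta : R) : S2 (sph phi theta).
Proof. apply (sph_HM phi theta). Qed.

Lemma Derive_sph (f g : vec -> R) (phi theta : R) :
  smooth g -> (forall p, S2 p -> f p = g p) ->
  Derive (fun t => f (sph t theta)) phi = dirD (sph_phi phi theta) g (sph phi theta).
Proof.
  intros Hg Hf; rewrite (Derive_ext _ (fun t => g (sph t theta)))
    by (intros t; apply Hf, S2_sph).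
  apply is_derive_unique, (smooth_chain g (fun t => sph t theta)), is_vderive_sph_phi; exact Hg.
Qed.

(** A meridian is a great circle, so its acceleration is [- p]. *)
Lemma Derive_2_sph_phi (f g : vec -> R) (phi theta : R) :
  smooth g -> (forall p, S2 p -> f p = g p) ->
  Derive_n (fun t => f (sph t theta)) 2 phi =
  hess g (sph phi theta) (sph_phi phi theta) (sph_phi phi theta)
  - dirD (sph phi theta) g (sph phi theta).
Proof.
  intros Hg Hf; cbn [Derive_n].
  rewrite (Derive_ext _ (fun t => dirD (sph_phi t theta) g (sph t theta)))
    by (intros t; apply Derive_sph; assumption).
  apply is_derive_unique; eapply is_derive_eq.
  - apply (smooth_chain_dirD g (fun t => sph t theta) (fun t => sph_phi t theta));
      [exact Hg | apply is_vderive_sph_phi | apply is_vderive_sph_phi_phi].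
  - cbv beta; rewrite dirD_vscal by exact Hg; ring.
Qed.

(** A parallel is a circle of radius [sin phi] about the axis; its acceleration, of
   length [sin phi], has a component along the meridian as well as one along [p]. *)
Lemma Derive_2_sph_theta (f g : vec -> R) (phi theta : R) :
  smooth g -> (forall p, S2 p -> f p = g p) ->
  Derive_n (fun t => f (sph phi t)) 2 theta =
  sin phi ^ 2 * (hess g (sph phi theta) (sph_unit_theta theta) (sph_unit_theta theta)
                 - dirD (sph phi theta) g (sph phi theta))
  - sin phi * cos phi * dirD (sph_phi phi theta) g (sph phi theta).
Proof.
  intros Hg Hf; cbn [Derive_n].
  rewrite (Derive_ext _ (fun t => dirD (vscal (sin phi) (sph_unit_theta t)) g (sph phi t))).
  2: { intros t; rewrite (Derive_ext _ (fun t => g (sph phi t)))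
         by (intros s; apply Hf, S2_sph).
       apply is_derive_unique, (smooth_chain g (fun t => sph phi t)), is_vderive_sph_theta; exact Hg. }
  apply is_derive_unique; eapply is_derive_eq.
  - apply (smooth_chain_dirD g (fun t => sph phi t) (fun t => vscal (sin phi) (sph_unit_theta t)));
      [exact Hg | apply is_vderive_sph_theta | apply is_vderive_sph_theta_theta].
  - cbv beta; rewrite dirD_linear, hess_vscal by exact Hg; unfold hess.
    rewrite dirD_vscal by (apply smooth_dirD, Hg); ring.
Qed.

(** * Integrals over a fibre *)

Ltac real_field := match goal with |- @eq _ ?a ?b => change (@eq R a b) end; field.

Lemma ex_RInt_of_continuous (h : R -> R) (a b : R) :
  (forall t, continuous h t) -> ex_RInt h a b.
Proof. intros H; apply (ex_RInt_continuous (V := R_CompleteNormedModule)); intros t _; apply H. Qed.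

Lemma RInt_shift (h : R -> R) (a : R) :
  (forall t, continuous h t) -> (forall t, h (t + 2 * PI) = h t) ->
  RInt (fun t => h (t + a)) 0 (2 * PI) = RInt h 0 (2 * PI).
Proof.
  intros Hc Hp.
  assert (Sh : forall b x y, RInt (fun t => h (t + b)) x y = RInt h (x + b) (y + b)).
  { intros b x y.
    pose proof (RInt_comp_lin h 1 b x y (ex_RInt_of_continuous _ _ _ Hc)) as E.
    rewrite !Rmult_1_l in E; rewrite <- E; apply RInt_ext; intros t _.
    unfold scal; cbn; unfold mult; cbn; rewrite !Rmult_1_l; reflexivity. }
  rewrite Sh, Rplus_0_l.
  assert (C : forall x y z, RInt h x y + RInt h y z = RInt h x z)
    by (intros x y z; apply (RInt_Chasles h); apply ex_RInt_of_continuous, Hc).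
  assert (E : RInt h 0 a = RInt h (2 * PI) (2 * PI + a)).
  { rewrite <- (Rplus_0_l (2 * PI)) at 1; rewrite (Rplus_comm (2 * PI) a), <- Sh.
    apply RInt_ext; intros t _; symmetry; apply Hp. }
  pose proof (C 0 a (2 * PI + a)); pose proof (C 0 (2 * PI) (2 * PI + a)); lra.
Qed.

(** Meant for integrands on a fibre: the half turn reverses the drift and preserves the
   root, so that the average [k] is free of what is odd in the drift. *)
Lemma RInt_half_turn (h k : R -> R) :
  (forall t, continuous h t) -> (forall t, h (t + 2 * PI) = h t) ->
  (forall t, h t + h (t + PI) = 2 * k t) ->
  RInt h 0 (2 * PI) = RInt k 0 (2 * PI).
Proof.
  intros Hc Hp Hk.
  assert (Hc' : forall t, continuous (fun t => h (t + PI)) t).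
  { intros t; apply (continuous_comp (fun t => t + PI) h); [ | apply Hc].
    apply (continuous_plus (fun t => t) (fun _ => PI)); [apply continuous_id | apply continuous_const]. }
  assert (E : RInt (fun t => / 2 * (h t + h (t + PI))) 0 (2 * PI) =
    / 2 * (RInt h 0 (2 * PI) + RInt (fun t => h (t + PI)) 0 (2 * PI))).
  { etransitivity.
    - apply (RInt_scal (fun t => h t + h (t + PI)) 0 (2 * PI) (/ 2)).
      apply (ex_RInt_plus h (fun t => h (t + PI))); apply ex_RInt_of_continuous; assumption.
    - unfold scal; cbn; unfold mult; cbn; f_equal.
      apply (RInt_plus h (fun t => h (t + PI))); apply ex_RInt_of_continuous; assumption. }
  rewrite (RInt_shift h PI Hc Hp) in E.
  transitivity (RInt (fun t => / 2 * (h t + h (t + PI))) 0 (2 * PI)).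
  { rewrite E; generalize (RInt h 0 (2 * PI) : R); intros x; real_field. }
  apply RInt_ext; intros t _; rewrite Hk; real_field.
Qed.

Lemma RInt_antiderivative (G h : R -> R) (a b l : R) :
  (forall t, is_derive G t (h t)) -> (forall t, continuous h t) -> G b - G a = l ->
  RInt h a b = l.
Proof.
  intros D C <-; apply is_RInt_unique.
  apply (is_RInt_derive G h); intros; [apply D | apply C].
Qed.

(** On the fibre through [(p, e)], with [A] and [B] the third coordinates of [eps e] and
   [eps (p x e)], these four functions are [eps] times the third coordinate of [u], and
   the [drift], [root] and [speed] of the metric. *)
Definition fiber_cos (A B t : R) : R := A * cos t + B * sin t.
Definition fiber_drift (A B t : R) : R := B * cos t - A * sin t.
Definition fiber_root (A B t : R) : R := sqrt (1 - fiber_cos A B t ^ 2).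
Definition fiber_speed (A B t : R) : R := fiber_root A B t + fiber_drift A B t.

Lemma fiber_cos_drift (A B t : R) : fiber_cos A B t ^ 2 + fiber_drift A B t ^ 2 = A ^ 2 + B ^ 2.
Proof.
  pose proof (sin2_cos2 t) as E; unfold Rsqr in E; unfold fiber_cos, fiber_drift.
  transitivity ((A ^ 2 + B ^ 2) * (sin t * sin t + cos t * cos t)); [ring | rewrite E; ring].
Qed.

Lemma fiber_root_arg_pos (A B t : R) : A ^ 2 + B ^ 2 < 1 -> 0 < 1 - fiber_cos A B t ^ 2.
Proof. intros H; pose proof (fiber_cos_drift A B t); nra. Qed.

Lemma fiber_root_pos (A B t : R) : A ^ 2 + B ^ 2 < 1 -> 0 < fiber_root A B t.
Proof. intros H; apply sqrt_lt_R0, fiber_root_arg_pos, H. Qed.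

Lemma fiber_root_sq (A B t : R) : A ^ 2 + B ^ 2 < 1 ->
  fiber_root A B t ^ 2 = 1 - fiber_cos A B t ^ 2.
Proof.
  intros H; rewrite <- Rsqr_pow2; apply Rsqr_sqrt, Rlt_le, fiber_root_arg_pos, H.
Qed.

Lemma fiber_speed_pos (A B t : R) : A ^ 2 + B ^ 2 < 1 -> 0 < fiber_speed A B t.
Proof.
  intros H; pose proof (fiber_root_sq A B t H); pose proof (fiber_cos_drift A B t).
  pose proof (fiber_root_pos A B t H); unfold fiber_speed; nra.
Qed.

(** Multiplication by the conjugate rationalizes [1 / (root + drift)]. *)
Lemma fiber_speed_conj (A B t : R) : A ^ 2 + B ^ 2 < 1 ->
  fiber_speed A B t * (fiber_root A B t - fiber_drift A B t) = 1 - A ^ 2 - B ^ 2.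
Proof.
  intros H; pose proof (fiber_root_sq A B t H); pose proof (fiber_cos_drift A B t).
  unfold fiber_speed; nra.
Qed.

Lemma fiber_cos_half_turn (A B t : R) : fiber_cos A B (t + PI) = - fiber_cos A B t.
Proof. unfold fiber_cos; rewrite neg_cos, neg_sin; ring. Qed.

Lemma fiber_drift_half_turn (A B t : R) : fiber_drift A B (t + PI) = - fiber_drift A B t.
Proof. unfold fiber_drift; rewrite neg_cos, neg_sin; ring. Qed.

Lemma fiber_root_half_turn (A B t : R) : fiber_root A B (t + PI) = fiber_root A B t.
Proof. unfold fiber_root; rewrite fiber_cos_half_turn; f_equal; ring. Qed.

Lemma cos_full_turn (t : R) : cos (t + 2 * PI) = cos t.
Proof. rewrite cos_plus, cos_2PI, sin_2PI; ring. Qed.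

Lemma sin_full_turn (t : R) : sin (t + 2 * PI) = sin t.
Proof. rewrite sin_plus, cos_2PI, sin_2PI; ring. Qed.

Lemma ex_derive_fiber_root (A B t : R) : A ^ 2 + B ^ 2 < 1 -> ex_derive (fiber_root A B) t.
Proof.
  intros H; pose proof (fiber_root_arg_pos A B t H) as Hp.
  unfold fiber_root, fiber_cos in *; auto_derive.
  match goal with |- 0 < ?x => replace x with (1 - (A * cos t + B * sin t) ^ 2) by ring end.
  exact Hp.
Qed.

(** For [B = 0] and [A^2 = 1 - l^2] this is the branch of [atan (tan t / l)] that is
   continuous for all [t], written by the subtraction formula for the arc tangent; in
   general [t] is translated by the phase of [(A, B)], up to an additive constant. *)
Definition fiber_angle (A B l t : R) : R :=
  t - atan (fiber_cos A B t * fiber_drift A B t / (1 + l - fiber_cos A B t ^ 2)).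

Lemma fiber_angle_full_turn (A B l : R) :
  fiber_angle A B l (2 * PI) - fiber_angle A B l 0 = 2 * PI.
Proof.
  unfold fiber_angle, fiber_cos, fiber_drift; rewrite cos_2PI, sin_2PI, cos_0, sin_0; ring.
Qed.

Lemma is_derive_fiber_angle (A B l t : R) : 0 < l -> A ^ 2 + B ^ 2 = 1 - l ^ 2 ->
  is_derive (fiber_angle A B l) t (l / (1 - fiber_cos A B t ^ 2)).
Proof.
  intros Hl HAB; unfold fiber_angle; pose proof (fiber_cos_drift A B t) as E.
  assert (Hp : 0 < 1 - fiber_cos A B t ^ 2) by (apply fiber_root_arg_pos; nra).
  assert (D1 : is_derive (fiber_cos A B) t (fiber_drift A B t))
    by (unfold fiber_cos, fiber_drift; auto_derive; trivial; ring).
  assert (D2 : is_derive (fiber_drift A B) t (- fiber_cos A B t))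
    by (unfold fiber_cos, fiber_drift; auto_derive; trivial; ring).
  rewrite HAB in E.
  set (u := fiber_cos A B) in *; set (v := fiber_drift A B) in *; clearbody u v.
  auto_derive.
  - repeat split; try lra; try (eexists; eassumption); nra.
  - replace (Derive (fun x => u x) t) with (v t) by (symmetry; apply is_derive_unique, D1).
    replace (Derive (fun x => v x) t) with (- u t) by (symmetry; apply is_derive_unique, D2).
    set (x := u t) in *; set (y := v t) in *; clearbody x y.
    assert (Hd : 1 + l - x ^ 2 <> 0) by nra.
    assert (Hy : y ^ 2 = 1 - l ^ 2 - x ^ 2) by lra.
    assert (Hs : (1 + l - x ^ 2) ^ 2 + (x * y) ^ 2 = (1 + l) ^ 2 * (1 - x ^ 2)).
    { replace ((x * y) ^ 2) with (x ^ 2 * y ^ 2) by ring; rewrite Hy; ring. }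
    assert (Hs0 : (1 + l - x ^ 2) ^ 2 + (x * y) ^ 2 <> 0)
      by (rewrite Hs; assert (0 < (1 + l) ^ 2) by (apply pow_lt; lra); nra).
    transitivity (1 - ((y ^ 2 - x ^ 2) * (1 + l - x ^ 2) + 2 * x ^ 2 * y ^ 2)
                      / ((1 + l - x ^ 2) ^ 2 + (x * y) ^ 2)).
    + field; split; intros K; [apply Hs0 | apply Hd]; rewrite <- K; ring.
    + rewrite Hs, Hy; field; lra.
Qed.

Lemma RInt_inv_root_sq (A B l : R) : 0 < l -> A ^ 2 + B ^ 2 = 1 - l ^ 2 ->
  RInt (fun t => / fiber_root A B t ^ 2) 0 (2 * PI) = 2 * PI / l.
Proof.
  intros Hl HAB; assert (H1 : A ^ 2 + B ^ 2 < 1) by nra.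
  apply (RInt_antiderivative (fun t => / l * fiber_angle A B l t)).
  - intros t; eapply is_derive_eq.
    + apply (is_derive_scal (fiber_angle A B l) t (/ l)), is_derive_fiber_angle; eassumption.
    + rewrite fiber_root_sq by exact H1; pose proof (fiber_root_arg_pos A B t H1).
      field; lra.
  - intros t; apply @ex_derive_continuous; pose proof (fiber_root_pos A B t H1) as Hp.
    pose proof (ex_derive_fiber_root A B t H1) as D.
    auto_derive; repeat split; trivial; nra.
  - transitivity (/ l * (fiber_angle A B l (2 * PI) - fiber_angle A B l 0)); [ring | ].
    rewrite fiber_angle_full_turn; field; lra.
Qed.

Lemma fiber_liouville_continuous (A B t : R) : A ^ 2 + B ^ 2 < 1 ->
  continuous (fun t => / (fiber_speed A B t * fiber_root A B t ^ 3)) t.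
Proof.
  intros H1; apply @ex_derive_continuous; pose proof (fiber_root_pos A B t H1) as Hp.
  pose proof (ex_derive_fiber_root A B t H1) as D; pose proof (fiber_speed_pos A B t H1) as Hv.
  unfold fiber_speed, fiber_drift in *.
  auto_derive; repeat split; trivial.
  apply Rgt_not_eq, Rmult_lt_0_compat; [lra | ].
  repeat apply Rmult_lt_0_compat; lra.
Qed.

(** Rationalizing the speed, the half-turn average of the integrand is
   [1 / (l^2 root^2)]. *)
Lemma RInt_fiber_liouville (A B l : R) : 0 < l -> A ^ 2 + B ^ 2 = 1 - l ^ 2 ->
  RInt (fun t => / (fiber_speed A B t * fiber_root A B t ^ 3)) 0 (2 * PI) = 2 * PI / l ^ 3.
Proof.
  intros Hl HAB; assert (H1 : A ^ 2 + B ^ 2 < 1) by nra.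
  rewrite (RInt_half_turn _ (fun t => / l ^ 2 * / fiber_root A B t ^ 2)).
  - etransitivity.
    + apply (RInt_scal (fun t => / fiber_root A B t ^ 2) 0 (2 * PI) (/ l ^ 2)).
      apply ex_RInt_of_continuous; intros t; apply @ex_derive_continuous.
      pose proof (fiber_root_pos A B t H1) as Hp.
      pose proof (ex_derive_fiber_root A B t H1) as D.
      auto_derive; repeat split; trivial; nra.
    + rewrite (RInt_inv_root_sq A B l Hl HAB); unfold scal; cbn; unfold mult; cbn; field; lra.
  - intros t; apply fiber_liouville_continuous, H1.
  - intros t; unfold fiber_speed, fiber_root, fiber_drift, fiber_cos.
    rewrite cos_full_turn, sin_full_turn; reflexivity.
  - intros t; unfold fiber_speed; rewrite fiber_root_half_turn, fiber_drift_half_turn.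
    pose proof (fiber_root_pos A B t H1) as Hr; pose proof (fiber_speed_pos A B t H1) as Hv.
    pose proof (fiber_speed_pos A B (t + PI) H1) as Hv'.
    pose proof (fiber_speed_conj A B t H1) as E.
    unfold fiber_speed in *; rewrite fiber_root_half_turn, fiber_drift_half_turn in Hv'.
    replace (l ^ 2) with ((fiber_root A B t + fiber_drift A B t)
      * (fiber_root A B t - fiber_drift A B t)) by lra.
    field; lra.
Qed.

Definition fiber_second (h11 h12 h22 t : R) : R :=
  cos t ^ 2 * h11 + cos t * sin t * h12 + sin t ^ 2 * h22.

(** The integrand of the Laplacian on a fibre: [h11], [h12], [h22] are the coefficients
   of the second derivative of the function in the basis [e], [p x e]; [dp], [d1], [d2]
   its first derivatives along [p], [e], [p x e]; [n] is [eps] times the height of [p];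
   [K] normalizes the angle form. *)
Definition fiber_profile (A B K n h11 h12 h22 dp d1 d2 t : R) : R :=
  (fiber_speed A B t ^ 2 * (fiber_second h11 h12 h22 t - dp)
   + n * (fiber_speed A B t + fiber_root A B t) * fiber_drift d1 d2 t
   - n * fiber_cos A B t * fiber_cos d1 d2 t)
  * (K * / (fiber_speed A B t * fiber_root A B t ^ 3)).

Lemma fiber_profile_continuous (A B K n h11 h12 h22 dp d1 d2 t : R) : A ^ 2 + B ^ 2 < 1 ->
  continuous (fiber_profile A B K n h11 h12 h22 dp d1 d2) t.
Proof.
  intros H1; apply @ex_derive_continuous; pose proof (fiber_root_pos A B t H1) as Hp.
  pose proof (ex_derive_fiber_root A B t H1) as D; pose proof (fiber_speed_pos A B t H1) as Hv.
  unfold fiber_profile, fiber_second, fiber_speed, fiber_drift, fiber_cos in *.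
  auto_derive; repeat split; trivial.
  apply Rgt_not_eq, Rmult_lt_0_compat; [lra | ].
  repeat apply Rmult_lt_0_compat; lra.
Qed.

Lemma fiber_profile_periodic (A B K n h11 h12 h22 dp d1 d2 t : R) :
  fiber_profile A B K n h11 h12 h22 dp d1 d2 (t + 2 * PI) =
  fiber_profile A B K n h11 h12 h22 dp d1 d2 t.
Proof.
  unfold fiber_profile, fiber_second, fiber_speed, fiber_root, fiber_drift, fiber_cos.
  rewrite cos_full_turn, sin_full_turn; reflexivity.
Qed.

Lemma fiber_cos_drift_dot (A B a b t : R) :
  fiber_cos A B t * fiber_cos a b t + fiber_drift A B t * fiber_drift a b t = A * a + B * b.
Proof.
  pose proof (sin2_cos2 t) as E; unfold Rsqr in E; unfold fiber_cos, fiber_drift.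
  transitivity ((A * a + B * b) * (sin t * sin t + cos t * cos t)); [ring | rewrite E; ring].
Qed.

(** After the average, the first-order terms carry the products
   [fiber_cos A B * fiber_cos d1 d2] and [fiber_drift A B * fiber_drift d1 d2] with equal
   coefficients, and their sum is constant on the fibre by [fiber_cos_drift_dot]. *)
Lemma RInt_fiber_profile (A B K n h11 h12 h22 dp d1 d2 : R) : A ^ 2 + B ^ 2 < 1 ->
  RInt (fiber_profile A B K n h11 h12 h22 dp d1 d2) 0 (2 * PI) =
  RInt (fun t => K * (fiber_second h11 h12 h22 t - dp
                      - n * (A * d1 + B * d2) / (1 - A ^ 2 - B ^ 2))
                 / fiber_root A B t ^ 2) 0 (2 * PI).
Proof.
  intros H1; apply RInt_half_turn.
  - intros t; apply fiber_profile_continuous, H1.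
  - intros t; apply fiber_profile_periodic.
  - intros t; unfold fiber_profile.
    assert (E2 : fiber_second h11 h12 h22 (t + PI) = fiber_second h11 h12 h22 t)
      by (unfold fiber_second; rewrite neg_cos, neg_sin; ring).
    rewrite <- (fiber_speed_conj A B t H1), <- (fiber_cos_drift_dot A B d1 d2 t).
    rewrite E2, (fiber_cos_half_turn A B), (fiber_cos_half_turn d1 d2), (fiber_drift_half_turn d1 d2).
    pose proof (fiber_root_pos A B t H1) as Hr; pose proof (fiber_speed_pos A B t H1) as Hv.
    pose proof (fiber_speed_pos A B (t + PI) H1) as Hv'.
    unfold fiber_speed in *; rewrite fiber_root_half_turn, fiber_drift_half_turn in *.
    field; lra.
Qed.

(** As [root^2 = 1 - A^2 cos^2 t], the numerator is a constant, plus a multiple of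
   [root^2], plus [b cos t sin t]; these integrate to [fiber_angle], [t] and a periodic
   logarithm. *)
Lemma RInt_second_over_root_sq (A l a b d : R) : 0 < l -> A <> 0 -> A ^ 2 = 1 - l ^ 2 ->
  RInt (fun t => fiber_second a b d t / fiber_root A 0 t ^ 2) 0 (2 * PI) =
  2 * PI * (a / (l * (1 + l)) + d / (1 + l)).
Proof.
  intros Hl HA HAl; assert (H1 : A ^ 2 + 0 ^ 2 < 1) by nra.
  assert (HAB : A ^ 2 + 0 ^ 2 = 1 - l ^ 2) by lra.
  set (k0 := d + (a - d) / A ^ 2); set (k1 := - ((a - d) / A ^ 2)).
  apply (RInt_antiderivative (fun t => k0 / l * fiber_angle A 0 l t
    + (k1 * t + b / (2 * A ^ 2) * ln (1 - fiber_cos A 0 t ^ 2)))).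
  - intros t; pose proof (fiber_root_arg_pos A 0 t H1) as Hp.
    eapply is_derive_eq.
    + apply is_derive_plus'.
      * apply (is_derive_scal (fiber_angle A 0 l) t (k0 / l)), is_derive_fiber_angle; eassumption.
      * assert (D : is_derive (fun t => k1 * t + b / (2 * A ^ 2) * ln (1 - fiber_cos A 0 t ^ 2)) t
          (k1 + b / A ^ 2 * (- fiber_cos A 0 t * fiber_drift A 0 t) / (1 - fiber_cos A 0 t ^ 2))); [ | exact D].
        unfold fiber_drift, fiber_cos in *; auto_derive; [lra | ].
        field; repeat split; try lra.
    + rewrite fiber_root_sq by exact H1; unfold k0, k1, fiber_second.
      unfold fiber_cos, fiber_drift in *.
      pose proof (sin2_cos2 t) as E; unfold Rsqr in E.
      replace (sin t ^ 2) with (1 - cos t ^ 2) by lra.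
      field; repeat split; try lra; nra.
  - intros t; apply @ex_derive_continuous; pose proof (fiber_root_pos A 0 t H1) as Hp.
    pose proof (ex_derive_fiber_root A 0 t H1) as D; unfold fiber_second.
    auto_derive; repeat split; trivial; nra.
  - transitivity (k0 / l * (fiber_angle A 0 l (2 * PI) - fiber_angle A 0 l 0) + k1 * (2 * PI)).
    + unfold fiber_cos; rewrite cos_2PI, sin_2PI, cos_0, sin_0; ring.
    + rewrite fiber_angle_full_turn; unfold k0, k1; rewrite HAl; field; repeat split; try lra; nra.
Qed.

(** * The Katok-Ziller metric and its Hilbert form *)

Section Katok.
Variable eps : R.
Hypothesis Heps : 0 < eps < 1.

(** The navigation data of the metric: the field [W], and [1 - |W|^2] at points of the
   sphere. *)
Definition wind (p : vec) : vec := vscal eps (mkvec (- cy p) (cx p) 0).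
Definition slack (p : vec) : R := 1 - eps ^ 2 * (1 - cz p ^ 2).

(** For nonzero [v], the positive root [r] of [|v / r - W| = 1]. *)
Definition zermelo (p v : vec) : R :=
  (sqrt (slack p * dot v v + dot v (wind p) ^ 2) - dot v (wind p)) / slack p.

(** In spherical coordinates [|v|^2 = xi_phi^2 + sin^2 phi xi_theta^2] and
   [v . W = eps sin^2 phi xi_theta], which identifies the two radicands. *)
Lemma katok_ziller_zermelo (F : vec -> vec -> R) : is_katok_ziller eps F ->
  forall p v, S2 p -> TS2 p v -> F p v = zermelo p v.
Proof.
  intros HF p v Hp Hv.
  destruct (sph_surjective p v Hp Hv) as (phi & t & a & b & H1 & H2 & -> & ->).
  rewrite HF by trivial; unfold zermelo.
  pose proof (sin2_cos2 phi) as E1; pose proof (sin2_cos2 t) as E2; unfold Rsqr in *.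
  assert (Es : slack (sph phi t) = 1 - eps ^ 2 * sin phi ^ 2)
    by (unfold slack, sph, mkvec, cz; cbn [fst snd]; nra).
  set (v := vadd _ _) in *.
  assert (Ew : dot v (wind (sph phi t)) = eps * sin phi ^ 2 * b).
  { transitivity (eps * sin phi ^ 2 * b * (sin t * sin t + cos t * cos t)); [ | rewrite E2; ring].
    unfold v, wind, sph, sph_phi, sph_theta; vec_ring. }
  assert (Ev : dot v v = a ^ 2 + sin phi ^ 2 * b ^ 2).
  { transitivity (a ^ 2 * (cos phi * cos phi * (sin t * sin t + cos t * cos t) + sin phi * sin phi)
      + sin phi ^ 2 * b ^ 2 * (sin t * sin t + cos t * cos t)).
    - unfold v, sph_phi, sph_theta; vec_ring.
    - rewrite E2, Rmult_1_r, (Rplus_comm _ (sin phi * sin phi)), E1; ring. }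
  rewrite Es, Ew, Ev.
  replace ((1 - eps ^ 2 * sin phi ^ 2) * (a ^ 2 + sin phi ^ 2 * b ^ 2) +
    (eps * sin phi ^ 2 * b) ^ 2)
    with ((1 - eps ^ 2 * sin phi ^ 2) * a ^ 2 + sin phi ^ 2 * b ^ 2) by ring.
  unfold Rdiv; ring.
Qed.

Definition root (z : vec2) : R := sqrt (1 - (eps * cz (snd z)) ^ 2).
Definition drift (z : vec2) : R := eps * cz (normal z).

(** The Euclidean length of the vector of F-length one in the direction [u], that is
   [1 / F p u], by the identity [root_drift_slack]. *)
Definition speed (z : vec2) : R := root z + drift z.

(** The derivative of [1 / speed] along the fibre. *)
Definition slope (z : vec2) : R := eps * cz (snd z) / (root z * speed z).

Lemma slack_pos (p : vec) : 0 < slack p.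
Proof. unfold slack; nra. Qed.

Lemma root_arg_pos (z : vec2) : HM z -> 0 < 1 - (eps * cz (snd z)) ^ 2.
Proof. intros H; pose proof (HM_cz_squares z H) as E; nra. Qed.

Lemma root_pos (z : vec2) : HM z -> 0 < root z.
Proof. intros H; apply sqrt_lt_R0, root_arg_pos, H. Qed.

Lemma root_sq (z : vec2) : HM z -> root z ^ 2 = 1 - (eps * cz (snd z)) ^ 2.
Proof.
  intros H; rewrite <- Rsqr_pow2; apply Rsqr_sqrt, Rlt_le, root_arg_pos, H.
Qed.

Lemma root_drift_slack (z : vec2) : HM z -> root z ^ 2 = slack (fst z) + drift z ^ 2.
Proof.
  intros H; rewrite root_sq by trivial; pose proof (HM_cz_squares z H) as E.
  unfold slack, drift; nra.
Qed.

Lemma speed_pos (z : vec2) : HM z -> 0 < speed z.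
Proof.
  intros H; pose proof (root_drift_slack z H) as E; pose proof (slack_pos (fst z)) as Hs.
  pose proof (root_pos z H) as Hr; unfold speed; nra.
Qed.

Lemma dot_snd_wind (z : vec2) : dot (snd z) (wind (fst z)) = drift z.
Proof. unfold wind, drift, normal; vec_ring. Qed.

Lemma dot_normal_wind (z : vec2) : HM z -> dot (normal z) (wind (fst z)) = - (eps * cz (snd z)).
Proof.
  intros H; pose proof (f_equal cz (cross_fst_normal z H)) as E.
  transitivity (eps * cz (cross (fst z) (normal z))).
  - set (n := normal z); clearbody n; unfold wind; vec_ring.
  - rewrite E; unfold vscal, mkvec, cz; cbn [fst snd]; ring.
Qed.

(** The gradient of [F] along the fibre: its components on [u] and [p x u] are the value
   of [F], by homogeneity, and its angular derivative. *)
Definition covector (z : vec2) : vec :=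
  vadd (vscal (/ speed z) (snd z)) (vscal (slope z) (normal z)).

Lemma hilbert_covector (F : vec -> vec -> R) : is_katok_ziller eps F ->
  forall z w, HM z -> dot (fst w) (fst z) = 0 ->
    hilbert F z w = dot (covector z) (fst w).
Proof.
  intros HF z w Hz Hw; unfold hilbert.
  transitivity (Derive (fun s => zermelo (fst z) (vadd (snd z) (vscal s (fst w)))) 0).
  { apply Derive_ext; intros s; apply katok_ziller_zermelo; trivial; [apply Hz | ].
    unfold TS2; rewrite dot_vadd_r, dot_vscal_r, (dot_comm (fst z) (fst w)), Hw.
    destruct Hz as [_ [E _]]; unfold TS2 in E; rewrite E; ring. }
  pose proof (root_drift_slack z Hz) as Er; pose proof (root_pos z Hz) as Hr.
  pose proof (speed_pos z Hz) as Hv; pose proof (slack_pos (fst z)) as Hs.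
  assert (Ew : fst w = vadd (vscal (dot (fst w) (snd z)) (snd z))
                            (vscal (dot (fst w) (normal z)) (normal z))).
  { pose proof (HM_expand z (fst w) Hz) as E; rewrite Hw in E; rewrite E at 1.
    set (n := normal z); clearbody n; vec_ring. }
  assert (Eww : dot (fst w) (wind (fst z)) =
    dot (fst w) (snd z) * drift z - dot (fst w) (normal z) * (eps * cz (snd z))).
  { rewrite Ew at 1; rewrite dot_vadd_l, !dot_vscal_l, dot_snd_wind, dot_normal_wind by trivial.
    ring. }
  assert (Eroot : root z = sqrt (slack (fst z) + drift z ^ 2))
    by (rewrite <- Er, <- Rsqr_pow2, sqrt_Rsqr; lra).
  apply is_derive_unique; unfold zermelo.
  apply (is_derive_ext (fun s =>
    (sqrt (slack (fst z) * (1 + 2 * s * dot (fst w) (snd z) + s ^ 2 * dot (fst w) (fst w))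
           + (drift z + s * dot (fst w) (wind (fst z))) ^ 2)
     - (drift z + s * dot (fst w) (wind (fst z)))) / slack (fst z))).
  { intros s; rewrite <- dot_snd_wind.
    rewrite (dot_vadd_l _ _ (wind (fst z))), dot_vscal_l.
    rewrite dot_vadd_l, !dot_vadd_r, !dot_vscal_r, !dot_vscal_l, (dot_comm (snd z) (fst w)).
    destruct Hz as [_ [_ ->]].
    f_equal; f_equal; f_equal; ring. }
  pose proof (root_sq z Hz) as Er2.
  unfold covector; rewrite dot_vadd_l, !dot_vscal_l, (dot_comm (snd z)), (dot_comm (normal z)).
  rewrite Eww; unfold slope, speed in *.
  set (a := dot (fst w) (snd z)) in *; set (b := dot (fst w) (normal z)) in *.
  set (lam := slack (fst z)) in *; set (be := drift z) in *.
  set (ga := eps * cz (snd z)) in *.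
  auto_derive.
  - replace (_ + _) with (lam + be ^ 2) by ring; nra.
  - match goal with |- context [sqrt ?x] => replace x with (lam + be ^ 2) by ring end.
    rewrite <- Eroot; set (r := root z) in *; clearbody r a b lam be ga.
    assert (lam = (r - be) * (r + be)) by nra.
    assert (be ^ 2 = r ^ 2 - lam) by lra.
    assert (r - be <> 0) by nra.
    subst lam; field_simplify_eq; [ nra | repeat split; lra].
Qed.

Lemma is_vderive_normal (z : vec2) (c : R -> vec2) (a b d : R) :
  HM z -> c 0 = z -> is_vderive2 c 0 (frame_vec z a b d) ->
  is_vderive (fun s => normal (c s)) 0 (vadd (vscal (- b) (fst z)) (vscal (- d) (snd z))).
Proof.
  intros Hz c0 Dc.
  destruct Dc as [D1 D2]; pose proof (is_vderive_cross _ _ _ _ _ D1 D2) as D.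
  cbv beta in D; rewrite c0 in D.
  pose proof (cross_fst_normal z Hz) as E1; pose proof (cross_normal_snd z Hz) as E2.
  replace (vadd (vscal (- b) (fst z)) (vscal (- d) (snd z))) with
    (vadd (cross (fst (frame_vec z a b d)) (snd z)) (cross (fst z) (snd (frame_vec z a b d))));
    [exact D | unfold frame_vec; cbn [fst snd]].
  transitivity (vadd (vscal b (cross (normal z) (snd z))) (vscal d (cross (fst z) (normal z)))).
  - clear; generalize (fst z) (snd z) (normal z); vec_ring.
  - rewrite E1, E2; clear; generalize (fst z) (snd z); vec_ring.
Qed.

Lemma is_derive_cz_snd (z : vec2) (c : R -> vec2) (a b d : R) :
  HM z -> c 0 = z -> is_vderive2 c 0 (frame_vec z a b d) ->
  is_derive (fun s => cz (snd (c s))) 0 (- a * cz (fst z) + d * cz (normal z)).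
Proof.
  intros Hz c0 Dc; exact (proj2 (proj2 (proj2 Dc))). Qed.

Lemma is_derive_root (z : vec2) (c : R -> vec2) (a b d : R) :
  HM z -> c 0 = z -> is_vderive2 c 0 (frame_vec z a b d) ->
  is_derive (fun s => root (c s)) 0
    (- (eps ^ 2 * cz (snd z) * (- a * cz (fst z) + d * cz (normal z))) / root z).
Proof.
  intros Hz c0 Dc.
  pose proof (is_derive_cz_snd z c a b d Hz c0 Dc) as D; pose proof (root_arg_pos z Hz) as Hp.
  pose proof (root_pos z Hz) as Hr.
  unfold root; rewrite <- c0 in Hp.
  eapply is_derive_eq.
  - apply (is_derive_sqrt (fun s => 1 - (eps * cz (snd (c s))) ^ 2)); [ | exact Hp].
    apply (is_derive_comp (fun x => 1 - (eps * x) ^ 2) (fun s => cz (snd (c s)))); [ | exact D].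
    auto_derive; trivial.
  - cbv beta; rewrite !c0; fold (root z); unfold scal; cbn; unfold mult; cbn; field; lra.
Qed.

Lemma is_derive_speed (z : vec2) (c : R -> vec2) (a b d : R) :
  HM z -> c 0 = z -> is_vderive2 c 0 (frame_vec z a b d) ->
  is_derive (fun s => speed (c s)) 0
    (- (eps ^ 2 * cz (snd z) * (- a * cz (fst z) + d * cz (normal z))) / root z
     - eps * (b * cz (fst z) + d * cz (snd z))).
Proof.
  intros Hz c0 Dc.
  unfold speed; eapply is_derive_eq.
  - apply is_derive_plus'; [exact (is_derive_root z c a b d Hz c0 Dc) | ].
    apply (is_derive_scal (fun s => cz (normal (c s)))).
    exact (proj2 (proj2 (is_vderive_normal z c a b d Hz c0 Dc))).
  - unfold vadd, vscal, mkvec, cz; cbn; ring.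
Qed.

Lemma is_derive_slope (z : vec2) (c : R -> vec2) (a b d : R) :
  HM z -> c 0 = z -> is_vderive2 c 0 (frame_vec z a b d) ->
  is_derive (fun s => slope (c s)) 0
   (let u' := - a * cz (fst z) + d * cz (normal z) in
    let r' := - (eps ^ 2 * cz (snd z) * u') / root z in
    let v' := r' - eps * (b * cz (fst z) + d * cz (snd z)) in
    eps * u' / (root z * speed z) -
    eps * cz (snd z) * (r' * speed z + root z * v') / (root z * speed z) ^ 2).
Proof.
  intros Hz c0 Dc.
  pose proof (root_pos z Hz) as Hr; pose proof (speed_pos z Hz) as Hv.
  unfold slope; eapply is_derive_eq.
  - apply (is_derive_div (fun s => eps * cz (snd (c s))) (fun s => root (c s) * speed (c s))).
    + apply (is_derive_scal (fun s => cz (snd (c s)))) , (is_derive_cz_snd z c a b d Hz c0 Dc).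
    + apply is_derive_mult'; [exact (is_derive_root z c a b d Hz c0 Dc) | exact (is_derive_speed z c a b d Hz c0 Dc)].
    + rewrite c0; nra.
  - cbv beta zeta; rewrite !c0; field; lra.
Qed.

Lemma is_derive_covector (z : vec2) (c : R -> vec2) (a b d : R) (w : vec2) (a' b' d' : R) :
  HM z -> c 0 = z -> is_vderive2 c 0 (frame_vec z a b d) -> w = frame_vec z a' b' d' ->
  is_derive (fun s => dot (covector (c s)) (fst w)) 0
   (let u' := - a * cz (fst z) + d * cz (normal z) in
    let r' := - (eps ^ 2 * cz (snd z) * u') / root z in
    let v' := r' - eps * (b * cz (fst z) + d * cz (snd z)) in
    - v' / speed z ^ 2 * a' + d * b' / speed z +
    (eps * u' / (root z * speed z) -
     eps * cz (snd z) * (r' * speed z + root z * v') / (root z * speed z) ^ 2) * b'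
    - slope z * d * a').
Proof.
  intros Hz c0 Dc.
  intros Hw.
  pose proof (root_pos z Hz) as Hr; pose proof (speed_pos z Hz) as Hv.
  destruct (frame_dots z a' b' d' Hz) as (F1 & F2 & F3 & F4 & F5 & F6).
  rewrite <- Hw in *.
  apply (is_derive_ext (fun s => / speed (c s) * dot (snd (c s)) (fst w)
                                 + slope (c s) * dot (normal (c s)) (fst w))).
  { intros s; unfold covector; rewrite dot_vadd_l, !dot_vscal_l; reflexivity. }
  assert (K : is_vderive (fun _ => fst w) 0 vzero)
    by (split3; apply @is_derive_const).
  eapply is_derive_eq.
  - apply is_derive_plus'; apply is_derive_mult'.
    + apply (is_derive_inv (fun s => speed (c s))); [exact (is_derive_speed z c a b d Hz c0 Dc) | rewrite c0; lra].
    + exact (is_derive_dot _ _ _ _ _ (proj2 Dc) K).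
    + exact (is_derive_slope z c a b d Hz c0 Dc).
    + exact (is_derive_dot _ _ _ _ _ (is_vderive_normal z c a b d Hz c0 Dc) K).
  - cbv beta zeta; rewrite !c0.
    assert (Z1 : forall x, dot x vzero = 0) by vec_ring.
    rewrite !Z1, !Rplus_0_r, (dot_comm (snd z)), (dot_comm (normal z)), F2, F3.
    destruct (frame_dots z a b d Hz) as (G1 & G2 & G3 & G4 & G5 & G6).
    unfold frame_vec at 1; cbn [snd].
    rewrite !dot_vadd_l, !dot_vscal_l, (dot_comm (normal z)), F3.
    rewrite (dot_comm (fst z)), F1, (dot_comm (snd z)), F2.
    generalize dependent (root z); generalize dependent (speed z); intros.
    generalize (slope z) (cz (fst z)) (cz (snd z)) (cz (normal z)); intros.
    field; lra.
Qed.

Lemma dot_covector_fst (z : vec2) : HM z -> dot (covector z) (fst z) = 0.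
Proof.
  intros [_ [H _]]; unfold covector, TS2 in *.
  rewrite dot_vadd_l, !dot_vscal_l, (dot_comm (snd z)), H, (dot_comm (normal z)).
  unfold normal; rewrite dot_cross_l; ring.
Qed.

(** Normalizing the base point divides its velocity by its length and changes it by a
   multiple of [p], which the covector annihilates. *)
Lemma pullback_hilbert_line (F : vec -> vec -> R) : is_katok_ziller eps F ->
  forall z w1 w2 s, HM z -> THM z w1 ->
    pullback_retr (hilbert F) (line z w1 s) w2 =
    / sqrt (dot (fst (line z w1 s)) (fst (line z w1 s))) *
      dot (covector (retr_curve z w1 s)) (fst w2).
Proof.
  intros HF z w1 w2 s Hz Hw1; pose proof (line_fst_pos z w1 s Hz Hw1) as Hpos.
  pose proof (retr_curve_HM z w1 s Hz Hw1) as Hc; unfold retr_curve in *.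
  set (x := line z w1 s) in *; unfold pullback_retr.
  assert (D : fst (vDerive2 (fun r => retr (vadd2 x (vscal2 r w2))) 0) =
    vscal (/ sqrt (dot (fst x) (fst x)))
      (vadd (fst w2) (vscal (- dot (fst w2) (fst (retr x))) (fst (retr x))))).
  { pose proof (is_vderive_fst_retr x w2 0) as D; unfold retr_curve in D.
    rewrite line_0 in D; exact (vDerive_unique _ _ _ (D Hpos)). }
  assert (HP : dot (fst (retr x)) (fst (retr x)) = 1) by apply Hc.
  rewrite (hilbert_covector F HF); [ | exact Hc | ].
  - rewrite D, dot_vscal_r, dot_vadd_r, dot_vscal_r, dot_covector_fst by exact Hc; ring.
  - rewrite D, dot_vscal_l, dot_vadd_l, dot_vscal_l, HP; ring.
Qed.

(** The length of the base point is stationary at the start of a tangent line. *)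
Lemma is_derive_pullback (F : vec -> vec -> R) (z w1 w2 : vec2) (l : R) :
  is_katok_ziller eps F -> HM z -> THM z w1 ->
  is_derive (fun s => dot (covector (retr_curve z w1 s)) (fst w2)) 0 l ->
  Derive (fun s => pullback_retr (hilbert F) (vadd2 z (vscal2 s w1)) w2) 0 = l.
Proof.
  intros HF Hz Hw1 D; apply is_derive_unique.
  apply (is_derive_ext (fun s =>
    / sqrt (dot (fst (line z w1 s)) (fst (line z w1 s))) *
      dot (covector (retr_curve z w1 s)) (fst w2))).
  { intros s; symmetry; apply (pullback_hilbert_line F HF z w1 w2 s Hz Hw1). }
  assert (DL : is_vderive (fun s => fst (line z w1 s)) 0 (fst w1)) by apply is_vderive_line.
  pose proof (is_derive_inv_norm _ _ _ DL (line_fst_pos z w1 0 Hz Hw1)) as DN.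
  eapply is_derive_eq; [apply is_derive_mult'; [exact DN | exact D] | cbv beta].
  rewrite !line_0.
  destruct Hz as [H1 _], Hw1 as [T1 _]; unfold S2 in H1.
  rewrite H1, T1, sqrt_1; field.
Qed.

(** The derivative of [slope] along [(u, -p)] minus that of [1 / speed] along
   [(p x u, 0)]. *)
Definition twist (z : vec2) : R :=
  - (eps * cz (fst z) * (speed z + root z) / (speed z ^ 2 * root z ^ 3)).

(** The coefficient [root^(-3)] is [F + F''] for derivatives along the fibre, so its
   positivity is the strong convexity of [F]; there is no term pairing the first and
   third coordinates because [slope] is the fibre derivative of [1 / speed]. *)
Lemma dform_hilbert (F : vec -> vec -> R) (z : vec2) (a1 a2 a3 b1 b2 b3 : R) :
  is_katok_ziller eps F -> HM z ->
  dform (hilbert F) z (frame_vec z a1 a2 a3) (frame_vec z b1 b2 b3) =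
  twist z * (a1 * b2 - a2 * b1) + / root z ^ 3 * (a3 * b2 - a2 * b3).
Proof.
  intros HF Hz; unfold dform.
  pose proof (frame_vec_THM z a1 a2 a3 Hz) as Ta; pose proof (frame_vec_THM z b1 b2 b3 Hz) as Tb.
  rewrite (is_derive_pullback F z _ _ _ HF Hz Ta
    (is_derive_covector z _ a1 a2 a3 _ b1 b2 b3 Hz (retr_curve_0 z _ Hz)
      (is_vderive_retr_curve z _ Hz Ta) eq_refl)).
  rewrite (is_derive_pullback F z _ _ _ HF Hz Tb
    (is_derive_covector z _ b1 b2 b3 _ a1 a2 a3 Hz (retr_curve_0 z _ Hz)
      (is_vderive_retr_curve z _ Hz Tb) eq_refl)).
  pose proof (root_pos z Hz) as Hr; pose proof (speed_pos z Hz) as Hv.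
  pose proof (root_sq z Hz) as Er.
  cbv zeta; unfold twist, slope, speed, drift in *.
  set (r := root z) in *; set (x1 := cz (fst z)); set (x2 := cz (snd z)) in *.
  set (x3 := cz (normal z)) in *; clearbody r x1 x2 x3.
  (* with the factor 1 = r^2 + (eps x2)^2 the identity holds for independent r, x1, x2, x3 *)
  match goal with |- _ = ?rhs => transitivity ((r ^ 2 + (eps * x2) ^ 2) * rhs) end.
  - field; lra.
  - rewrite Er; ring.
Qed.

(** * Contact volume and Reeb field *)

Lemma hilbert_frame (F : vec -> vec -> R) (z : vec2) (a b c : R) :
  is_katok_ziller eps F -> HM z ->
  hilbert F z (frame_vec z a b c) = a / speed z + slope z * b.
Proof.
  intros HF Hz; destruct (frame_dots z a b c Hz) as (F1 & F2 & F3 & _).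
  rewrite (hilbert_covector F HF) by trivial.
  unfold covector; rewrite dot_vadd_l, !dot_vscal_l.
  rewrite (dot_comm (snd z)), (dot_comm (normal z)), F2, F3; unfold Rdiv; ring.
Qed.

(** The density of [A ^ dA] in the frame, up to sign. *)
Definition liouville (z : vec2) : R := / (speed z * root z ^ 3).

Lemma liouville_pos (z : vec2) : HM z -> 0 < liouville z.
Proof.
  intros Hz; pose proof (root_pos z Hz); pose proof (speed_pos z Hz).
  apply Rinv_0_lt_compat, Rmult_lt_0_compat; [ | apply pow_lt]; assumption.
Qed.

Lemma AdA_frame (F : vec -> vec -> R) (z : vec2) (a1 a2 a3 b1 b2 b3 c1 c2 c3 : R) :
  is_katok_ziller eps F -> HM z ->
  AdA F z (frame_vec z a1 a2 a3) (frame_vec z b1 b2 b3) (frame_vec z c1 c2 c3) =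
  - liouville z * (a3 * (b1 * c2 - b2 * c1) + b3 * (c1 * a2 - c2 * a1)
                   + c3 * (a1 * b2 - a2 * b1)).
Proof.
  intros HF Hz; unfold AdA, wedge12.
  rewrite !hilbert_frame, !(dform_hilbert F) by trivial.
  pose proof (root_pos z Hz) as Hr; pose proof (speed_pos z Hz) as Hv.
  unfold liouville; field; lra.
Qed.

Lemma vert_frame (z : vec2) : vert z = frame_vec z 0 0 1.
Proof. unfold vert, frame_vec, normal; apply f_equal2; generalize (fst z) (snd z); vec_ring. Qed.

Lemma fiber_sign_katok (F : vec -> vec -> R) (z : vec2) :
  is_katok_ziller eps F -> HM z -> fiber_sign F z = -1.
Proof.
  intros HF Hz; unfold fiber_sign; rewrite vert_frame.
  replace (snd z, vscal (-1) (fst z)) with (frame_vec z 1 0 0) by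
    (unfold frame_vec; apply f_equal2; generalize (fst z) (snd z) (normal z); vec_ring).
  replace (cross (fst z) (snd z), vzero) with (frame_vec z 0 1 0) by
    (unfold frame_vec, normal; apply f_equal2; generalize (fst z) (snd z); vec_ring).
  rewrite AdA_frame by trivial; pose proof (liouville_pos z Hz).
  apply sign_eq_m1; lra.
Qed.

(** The equation [dA (X, vert) = 0] excludes the component on [(p x u, 0)], [A (X) = 1]
   fixes the first coordinate, and the third one compensates [twist]. *)
Definition reeb (z : vec2) : vec2 :=
  frame_vec z (speed z) 0 (eps * cz (fst z) * (speed z + root z) / speed z).

Lemma is_reeb_reeb (F : vec -> vec -> R) : is_katok_ziller eps F -> is_reeb F reeb.
Proof.
  intros HF z Hz; pose proof (root_pos z Hz) as Hr.
  pose proof (speed_pos z Hz) as Hv; unfold reeb; split3.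
  - apply frame_vec_THM, Hz.
  - rewrite hilbert_frame by trivial; field; lra.
  - intros w Hw; rewrite (THM_frame_vec z w Hz Hw), (dform_hilbert F) by trivial.
    unfold twist; field; lra.
Qed.

Lemma is_reeb_unique (F : vec -> vec -> R) (X : vec2 -> vec2) (z : vec2) :
  is_katok_ziller eps F -> is_reeb F X -> HM z -> X z = reeb z.
Proof.
  intros HF HX Hz; destruct (HX z Hz) as (HT & HA & HdA).
  pose proof (root_pos z Hz) as Hr; pose proof (speed_pos z Hz) as Hv.
  rewrite (THM_frame_vec z _ Hz HT) in *.
  set (a := dot (fst (X z)) (snd z)) in *; set (b := dot (fst (X z)) (normal z)) in *.
  set (c := dot (snd (X z)) (normal z)) in *; clearbody a b c.
  pose proof (HdA _ (frame_vec_THM z 0 0 1 Hz)) as H1.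
  pose proof (HdA _ (frame_vec_THM z 0 1 0 Hz)) as H2.
  rewrite (dform_hilbert F) in H1, H2 by trivial; rewrite hilbert_frame in HA by trivial.
  assert (Hr3 : 0 < root z ^ 3) by (apply pow_lt, Hr).
  assert (Hb : b = 0).
  { apply (Rmult_eq_reg_r (/ root z ^ 3)); [ | apply Rinv_neq_0_compat; lra].
    assert (E : - (b * / root z ^ 3) = 0) by (rewrite <- H1; ring); lra. }
  subst b; assert (Ha : a = speed z)
    by (transitivity (a / speed z * speed z); [field; lra | rewrite Rmult_0_r in HA; nra]).
  subst a; unfold reeb; f_equal.
  unfold twist in H2; apply (Rmult_eq_reg_r (/ root z ^ 3)); [ | apply Rinv_neq_0_compat; lra].
  match type of H2 with ?l = _ =>
    transitivity (l + eps * cz (fst z) * (speed z + root z) / speed z * / root z ^ 3) end;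
    [field; lra | rewrite H2; ring].
Qed.

(** * Second derivative along the Reeb field *)

Lemma Lie_reeb (X : vec2 -> vec2) (f g : vec -> R) (z : vec2) :
  (forall z, HM z -> X z = reeb z) -> smooth g -> (forall p, S2 p -> f p = g p) -> HM z ->
  Lie X (fun z' => f (fst z')) z = speed z * dirD (snd z) g (fst z).
Proof.
  intros HX Hg Hf Hz; unfold Lie; rewrite HX by exact Hz.
  assert (HT : THM z (reeb z)) by (apply frame_vec_THM, Hz).
  apply is_derive_unique; apply (is_derive_ext (fun s => g (fst (retr_curve z (reeb z) s)))).
  { intros s; symmetry; apply Hf, (retr_curve_HM z (reeb z) s Hz HT). }
  eapply is_derive_eq.
  - apply smooth_chain; [exact Hg | ].
    exact (proj1 (is_vderive_retr_curve z (reeb z) Hz HT)).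
  - cbv beta; rewrite retr_curve_0 by exact Hz; unfold reeb, frame_vec; cbn [fst].
    rewrite dirD_linear by exact Hg; ring.
Qed.

(** The base point moves with velocity [speed u], so two derivatives of [g] produce its
   second derivative in this direction and its derivative along the acceleration. The
   component of the acceleration on [u], a sum of fractions in [root] and [speed],
   collapses to [- eps^2] times the product of the third coordinates of [p] and [u]. *)
Lemma Lie_Lie_reeb (X : vec2 -> vec2) (f g : vec -> R) (z : vec2) :
  (forall z, HM z -> X z = reeb z) -> smooth g -> (forall p, S2 p -> f p = g p) -> HM z ->
  Lie X (Lie X (fun z' => f (fst z'))) z =
  speed z ^ 2 * (hess g (fst z) (snd z) (snd z) - dirD (fst z) g (fst z))
  + eps * cz (fst z) * (speed z + root z) * dirD (normal z) g (fst z)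
  - eps * cz (fst z) * (eps * cz (snd z)) * dirD (snd z) g (fst z).
Proof.
  intros HX Hg Hf Hz; unfold Lie at 1; rewrite HX by exact Hz.
  pose proof (root_pos z Hz) as Hr; pose proof (speed_pos z Hz) as Hv.
  assert (HT : THM z (reeb z)) by (apply frame_vec_THM, Hz).
  pose proof (is_vderive_retr_curve z (reeb z) Hz HT) as Dc.
  pose proof (retr_curve_0 z (reeb z) Hz) as c0.
  apply is_derive_unique; apply (is_derive_ext (fun s =>
    speed (retr_curve z (reeb z) s) *
    dirD (snd (retr_curve z (reeb z) s)) g (fst (retr_curve z (reeb z) s)))).
  { intros s; symmetry; apply (Lie_reeb X f g); trivial; apply (retr_curve_HM z (reeb z) s Hz HT). }
  eapply is_derive_eq.
  - apply is_derive_mult'.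
    + exact (is_derive_speed z _ _ _ _ Hz c0 Dc).
    + exact (smooth_chain_dirD g _ _ 0 _ _ Hg (proj1 Dc) (proj2 Dc)).
  - cbv beta; rewrite !c0; unfold reeb, frame_vec; cbn [fst snd]; unfold hess.
    rewrite !dirD_linear by (try apply smooth_dirD; exact Hg).
    unfold speed in *; unfold drift in *.
    generalize (dirD (normal z) (dirD (snd z) g) (fst z)) (dirD (snd z) (dirD (snd z) g) (fst z)).
    generalize (dirD (normal z) g (fst z)) (dirD (snd z) g (fst z)) (dirD (fst z) g (fst z)).
    intros; field; lra.
Qed.

Lemma slack_fiber (p e : vec) : HM (p, e) ->
  (eps * cz e) ^ 2 + (eps * cz (normal (p, e))) ^ 2 = 1 - slack p.
Proof.
  intros H; pose proof (HM_cz_squares _ H) as E; cbn [fst snd] in E; unfold slack.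
  transitivity (eps ^ 2 * (cz e ^ 2 + cz (normal (p, e)) ^ 2)); [ring | ].
  replace (cz e ^ 2 + _) with (1 - cz p ^ 2) by (clear Heps; lra); ring.
Qed.

Lemma fiber_pt_values (p e : vec) (t : R) : HM (p, e) ->
  let A := eps * cz e in let B := eps * cz (normal (p, e)) in
  eps * cz (snd (fiber_pt p e t)) = fiber_cos A B t /\
  root (fiber_pt p e t) = fiber_root A B t /\
  speed (fiber_pt p e t) = fiber_speed A B t.
Proof.
  intros H A B; subst A B.
  assert (E1 : eps * cz (snd (fiber_pt p e t)) =
    fiber_cos (eps * cz e) (eps * cz (normal (p, e))) t)
    by (unfold fiber_cos, fiber_pt, normal, vadd, vscal, mkvec, cz; cbn [fst snd]; ring).
  assert (E2 : root (fiber_pt p e t) = fiber_root (eps * cz e) (eps * cz (normal (p, e))) t)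
    by (unfold root, fiber_root; rewrite E1; reflexivity).
  split3; trivial.
  unfold speed, fiber_speed, drift; rewrite E2, normal_fiber_pt by exact H.
  unfold fiber_drift, vadd, vscal, normal, mkvec, cz; cbn [fst snd]; ring.
Qed.

Definition katok_profile (g : vec -> R) (p e : vec) : R -> R :=
  let n := normal (p, e) in
  fiber_profile (eps * cz e) (eps * cz n) (slack p * sqrt (slack p)) (eps * cz p)
    (hess g p e e) (hess g p e n + hess g p n e) (hess g p n n)
    (dirD p g p) (dirD e g p) (dirD n g p).

Lemma Lie_Lie_fiber (X : vec2 -> vec2) (f g : vec -> R) (p e : vec) (t : R) :
  (forall z, HM z -> X z = reeb z) -> smooth g -> (forall p, S2 p -> f p = g p) -> HM (p, e) ->
  Lie X (Lie X (fun z' => f (fst z'))) (fiber_pt p e t)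
    * (slack p * sqrt (slack p) * liouville (fiber_pt p e t)) =
  katok_profile g p e t.
Proof.
  intros HX Hg Hf H; destruct (fiber_pt_values p e t H) as (E1 & E2 & E3).
  rewrite (Lie_Lie_reeb X f g) by (trivial; apply fiber_pt_HM, H).
  unfold katok_profile, fiber_profile, liouville; rewrite E1, E2, E3, normal_fiber_pt by exact H.
  unfold fiber_pt; cbn [fst snd]; change (cross p e) with (normal (p, e)).
  set (n := normal (p, e)).
  rewrite !dirD_linear, hess_linear by exact Hg; unfold hess.
  rewrite !dirD_linear by (apply smooth_dirD, Hg).
  unfold fiber_second, fiber_drift, fiber_cos; ring.
Qed.


(** * The angle form *)

(** The factor that gives [liouville] the total mass [2 PI] on the fibre. *)
Definition fiber_mass (p : vec) : R := slack p * sqrt (slack p).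

Lemma fiber_mass_pos (p : vec) : 0 < fiber_mass p.
Proof.
  pose proof (slack_pos p) as H; apply Rmult_lt_0_compat; [ | apply sqrt_lt_R0]; exact H.
Qed.

Lemma RInt_liouville (p e : vec) : HM (p, e) ->
  RInt (fun t => liouville (fiber_pt p e t)) 0 (2 * PI) = 2 * PI / fiber_mass p.
Proof.
  intros H; pose proof (slack_pos p) as Hs.
  pose proof (sqrt_lt_R0 _ Hs) as Hl; pose proof (sqrt_sqrt _ (Rlt_le _ _ Hs)) as Hll.
  unfold fiber_mass; rewrite <- Hll at 1.
  replace (sqrt (slack p) * sqrt (slack p) * sqrt (slack p)) with (sqrt (slack p) ^ 3) by ring.
  rewrite <- (RInt_fiber_liouville (eps * cz e) (eps * cz (normal (p, e))) _ Hl).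
  - apply RInt_ext; intros t _; destruct (fiber_pt_values p e t H) as (_ & E2 & E3).
    unfold liouville; rewrite E2, E3; reflexivity.
  - rewrite (slack_fiber p e H); rewrite <- Hll at 1; ring.
Qed.

Lemma ex_RInt_liouville (p e : vec) : HM (p, e) ->
  ex_RInt (fun t => liouville (fiber_pt p e t)) 0 (2 * PI).
Proof.
  intros H; pose proof (slack_fiber p e H) as E; pose proof (slack_pos p) as Hs.
  apply (ex_RInt_ext (fun t => / (fiber_speed (eps * cz e) (eps * cz (normal (p, e))) t
    * fiber_root (eps * cz e) (eps * cz (normal (p, e))) t ^ 3))).
  - intros t _; destruct (fiber_pt_values p e t H) as (_ & E2 & E3).
    unfold liouville; rewrite E2, E3; reflexivity.
  - apply ex_RInt_of_continuous; intros t; apply fiber_liouville_continuous; lra.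
Qed.

Lemma fiber_integral_katok (F : vec -> vec -> R) (b : Defs.form1) (p e : vec) (h : R -> R) :
  is_katok_ziller eps F -> HM (p, e) ->
  (forall t, b (fiber_pt p e t) (vert (fiber_pt p e t)) = - h t) ->
  fiber_integral F b p e = RInt h 0 (2 * PI).
Proof.
  intros HF H Hb; unfold fiber_integral; cbv zeta; apply RInt_ext; intros t _.
  rewrite Hb, (fiber_sign_katok F) by (trivial; apply fiber_pt_HM, H); real_ring.
Qed.

Lemma frame_area (z : vec2) (a1 a2 a3 b1 b2 b3 : R) : HM z ->
  dot (fst z) (cross (fst (frame_vec z a1 a2 a3)) (fst (frame_vec z b1 b2 b3))) =
  a1 * b2 - a2 * b1.
Proof.
  intros H; pose proof (normal_unit z H) as Hn.
  transitivity ((a1 * b2 - a2 * b1) * dot (normal z) (normal z)); [ | rewrite Hn; ring].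
  transitivity ((a1 * b2 - a2 * b1) * dot (cross (fst z) (snd z)) (normal z)); [ | reflexivity].
  unfold frame_vec; cbn [fst snd]; generalize (fst z) (snd z) (normal z); vec_ring.
Qed.

Definition angle_form : Defs.form1 :=
  fun z w => - (fiber_mass (fst z) * liouville z * dot (snd w) (normal z)).

Definition katok_volume (p a b : vec) : R := dot p (cross a b) / fiber_mass p.

Lemma is_volume_form_katok : is_volume_form_S2 katok_volume.
Proof.
  intros p Hp; pose proof (fiber_mass_pos p) as HK; unfold katok_volume.
  split3.
  - intros c a b d _ _ _; replace (dot p (cross (vadd (vscal c a) b) d)) with
      (c * dot p (cross a d) + dot p (cross b d)) by (clear; vec_ring).
    field; lra.
  - intros a b _ _; replace (dot p (cross a b)) with (- dot p (cross b a)) by (clear; vec_ring).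
    field; lra.
  - destruct (HM_inhabited p Hp) as [e He].
    exists e, (normal (p, e)); split; [apply He | split; [apply dot_cross_l | ]].
    pose proof (frame_area (p, e) 1 0 0 0 1 0 He) as E; cbn [frame_vec fst snd] in E.
    replace (vadd (vscal 1 e) (vscal 0 (normal (p, e)))) with e in E
      by (generalize (normal (p, e)); clear; vec_ring).
    replace (vadd (vscal 0 e) (vscal 1 (normal (p, e)))) with (normal (p, e)) in E
      by (generalize (normal (p, e)); clear; vec_ring).
    rewrite E; replace (1 * 1 - 0 * 0) with 1 by ring.
    apply Rgt_not_eq, Rdiv_lt_0_compat; lra.
Qed.

Lemma is_angle_volume_katok (F : vec -> vec -> R) : is_katok_ziller eps F ->
  is_angle_volume F angle_form katok_volume.
Proof.
  intros HF; split; [ | split; [exact is_volume_form_katok | split3]].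
  - intros z _ c w1 w2 _ _; unfold angle_form, vadd2, vscal2; cbn [fst snd].
    rewrite dot_vadd_l, dot_vscal_l; ring.
  - intros z w Hz Hw Hv Hw0 K; apply Hw0.
    pose proof (fiber_mass_pos (fst z)) as HK; pose proof (liouville_pos z Hz) as HL.
    assert (E : dot (snd w) (normal z) = 0).
    { apply (Rmult_eq_reg_l (- (fiber_mass (fst z) * liouville z))); [ | nra].
      rewrite Rmult_0_r, <- K; unfold angle_form; ring. }
    rewrite (THM_frame_vec z w Hz Hw), E, Hv.
    unfold frame_vec; apply f_equal2; generalize (fst z) (snd z) (normal z); clear; vec_ring.
  - intros z w1 w2 w3 Hz H1 H2 H3.
    rewrite (THM_frame_vec z w1 Hz H1), (THM_frame_vec z w2 Hz H2), (THM_frame_vec z w3 Hz H3).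
    generalize (dot (fst w1) (snd z)) (dot (fst w1) (normal z)) (dot (snd w1) (normal z)).
    generalize (dot (fst w2) (snd z)) (dot (fst w2) (normal z)) (dot (snd w2) (normal z)).
    generalize (dot (fst w3) (snd z)) (dot (fst w3) (normal z)) (dot (snd w3) (normal z)).
    intros c1 c2 c3 b1 b2 b3 a1 a2 a3; rewrite (AdA_frame F) by trivial.
    unfold wedge12, pullback_S2, katok_volume, angle_form.
    rewrite !frame_area by exact Hz.
    destruct (frame_dots z a1 a2 a3 Hz) as (_ & _ & _ & _ & _ & ->).
    destruct (frame_dots z b1 b2 b3 Hz) as (_ & _ & _ & _ & _ & ->).
    destruct (frame_dots z c1 c2 c3 Hz) as (_ & _ & _ & _ & _ & ->).
    pose proof (fiber_mass_pos (fst z)) as HK; field; lra.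
  - intros p e H; pose proof (fiber_mass_pos p) as HK.
    rewrite (fiber_integral_katok F _ p e (fun t => fiber_mass p * liouville (fiber_pt p e t)) HF H).
    + etransitivity.
      * apply (RInt_scal (fun t => liouville (fiber_pt p e t)) 0 (2 * PI) (fiber_mass p)).
        exact (ex_RInt_liouville p e H).
      * rewrite (RInt_liouville p e H); unfold scal; cbn; unfold mult; cbn; field; lra.
    + intros t; pose proof (fiber_pt_HM p e t H) as Hz.
      unfold angle_form; rewrite vert_frame.
      destruct (frame_dots (fiber_pt p e t) 0 0 1 Hz) as (_ & _ & _ & _ & _ & ->).
      unfold fiber_pt; cbn [fst]; ring.
Qed.

Lemma volume_form_rules (Omega : vec -> vec -> vec -> R) (p : vec) :
  is_volume_form_S2 Omega -> S2 p ->
  (forall d, TS2 p d -> Omega p vzero d = 0) /\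
  (forall k v d, TS2 p v -> TS2 p d -> Omega p (vscal k v) d = k * Omega p v d) /\
  (forall v, TS2 p v -> Omega p v v = 0).
Proof.
  intros HO Hp; destruct (HO p Hp) as (L & S & _).
  assert (T0 : TS2 p vzero) by (unfold TS2; clear; vec_ring).
  assert (L0 : forall d, TS2 p d -> Omega p vzero d = 0).
  { intros d Hd; pose proof (L 1 vzero vzero d T0 T0 Hd) as E.
    replace (vadd (vscal 1 vzero) vzero) with vzero in E by (clear; vec_ring); lra. }
  split3; trivial.
  - intros k v d Hv Hd; pose proof (L k v vzero d Hv T0 Hd) as E; rewrite L0 in E by exact Hd.
    replace (vadd (vscal k v) vzero) with (vscal k v) in E by (clear; vec_ring); lra.
  - intros v Hv; pose proof (S v v Hv Hv); lra.
Qed.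

(** The change of basis is a rotation, of determinant one. *)
Lemma volume_form_frame (Omega : vec -> vec -> vec -> R) (p e : vec) (t : R) :
  is_volume_form_S2 Omega -> HM (p, e) ->
  Omega p (snd (fiber_pt p e t)) (normal (fiber_pt p e t)) = Omega p e (normal (p, e)).
Proof.
  intros HO H; pose proof (normal_fiber_pt p e t H) as En.
  destruct (HO p (proj1 H)) as (L & S & _).
  destruct (volume_form_rules Omega p HO (proj1 H)) as (_ & Lk & D).
  assert (Te : TS2 p e) by apply H.
  assert (Tn : TS2 p (normal (p, e))) by apply dot_cross_l.
  unfold fiber_pt at 1; cbn [snd]; rewrite En; change (cross p e) with (normal (p, e)).
  set (n := normal (p, e)) in *; clearbody n.
  assert (T : forall k v, TS2 p v -> TS2 p (vscal k v))
    by (intros k v Hv; unfold TS2 in *; rewrite dot_vscal_r, Hv; ring).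
  assert (Tv : forall v w, TS2 p v -> TS2 p w -> TS2 p (vadd v w))
    by (intros v w Hv Hw; unfold TS2 in *; rewrite dot_vadd_r, Hv, Hw; ring).
  rewrite L, Lk by auto.
  rewrite (S e), (S n), !L, !Lk by auto.
  rewrite (D e), (D n), (S n e) by auto.
  pose proof (sin2_cos2 t) as E; unfold Rsqr in E.
  transitivity (Omega p e n * (sin t * sin t + cos t * cos t)); [ring | rewrite E; ring].
Qed.

(** On [vert] and the lifts of [u] and [p x u] the wedge equation says that
   [alpha (vert) * Omega (u, p x u) = - liouville], and the second factor is the same
   number all along the fibre. *)
Lemma angle_volume_unique (F : vec -> vec -> R) (alpha : Defs.form1)
    (Omega : vec -> vec -> vec -> R) (p e : vec) (t : R) :
  is_katok_ziller eps F -> is_angle_volume F alpha Omega -> HM (p, e) ->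
  alpha (fiber_pt p e t) (vert (fiber_pt p e t)) = - (fiber_mass p * liouville (fiber_pt p e t)).
Proof.
  intros HF (_ & HO & _ & HW & HI) H.
  destruct (HO p (proj1 H)) as (_ & S & _).
  destruct (volume_form_rules Omega p HO (proj1 H)) as (L0 & _ & _).
  assert (T0 : TS2 p vzero) by (unfold TS2; clear; vec_ring).
  set (om := Omega p e (normal (p, e))).
  assert (Ho : forall t, alpha (fiber_pt p e t) (vert (fiber_pt p e t)) * om
                         = - liouville (fiber_pt p e t)).
  { intros s; pose proof (fiber_pt_HM p e s H) as Hz.
    pose proof (volume_form_frame Omega p e s HO H) as Eo; fold om in Eo.
    rewrite vert_frame; set (z := fiber_pt p e s) in *.
    assert (Tu : TS2 p (snd z)) by apply Hz.
    assert (Tn : TS2 p (normal z)) by apply dot_cross_l.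
    pose proof (HW z _ _ _ Hz (frame_vec_THM z 0 0 1 Hz) (frame_vec_THM z 1 0 0 Hz)
      (frame_vec_THM z 0 1 0 Hz)) as E.
    rewrite (AdA_frame F) in E by trivial; unfold wedge12, pullback_S2 in E.
    change (fst z) with p in E.
    replace (fst (frame_vec z 0 0 1)) with vzero in E
      by (unfold frame_vec; cbn [fst]; generalize (snd z) (normal z); clear; vec_ring).
    replace (fst (frame_vec z 1 0 0)) with (snd z) in E
      by (unfold frame_vec; cbn [fst]; generalize (snd z) (normal z); clear; vec_ring).
    replace (fst (frame_vec z 0 1 0)) with (normal z) in E
      by (unfold frame_vec; cbn [fst]; generalize (snd z) (normal z); clear; vec_ring).
    rewrite (S (normal z) vzero), !L0, Eo in E by trivial; lra. }
  assert (Hom : om <> 0).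
  { intros K; pose proof (Ho 0) as E; rewrite K in E.
    pose proof (liouville_pos _ (fiber_pt_HM p e 0 H)); lra. }
  pose proof (fiber_mass_pos p) as HK; pose proof PI_RGT_0 as Hpi.
  assert (Eal : forall t, alpha (fiber_pt p e t) (vert (fiber_pt p e t))
                          = - (/ om * liouville (fiber_pt p e t))).
  { intros s; apply (Rmult_eq_reg_r om); [rewrite Ho; field | ]; exact Hom. }
  (* the normalization of the fibre integral determines [om] *)
  pose proof (HI p e H) as E.
  rewrite (fiber_integral_katok F alpha p e _ HF H Eal) in E.
  assert (Em : / om * (2 * PI / fiber_mass p) = 2 * PI).
  { rewrite <- (RInt_liouville p e H); etransitivity; [ | exact E]; symmetry.
    apply (RInt_scal (fun t => liouville (fiber_pt p e t)) 0 (2 * PI) (/ om)).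
    exact (ex_RInt_liouville p e H). }
  rewrite Eal; f_equal; f_equal.
  apply (Rmult_eq_reg_r (2 * PI / fiber_mass p)); [rewrite Em; field; lra | ].
  apply Rgt_not_eq, Rdiv_lt_0_compat; lra.
Qed.

(** * The Laplacian *)

Lemma fiber_integral_Lie (F : vec -> vec -> R) (X : vec2 -> vec2) (alpha : Defs.form1)
    (Omega : vec -> vec -> vec -> R) (f g : vec -> R) (p e : vec) :
  is_katok_ziller eps F -> is_reeb F X -> is_angle_volume F alpha Omega ->
  smooth g -> (forall p, S2 p -> f p = g p) -> HM (p, e) ->
  fiber_integral F (fun z w => Lie X (Lie X (fun z' => f (fst z'))) z * alpha z w) p e =
  RInt (katok_profile g p e) 0 (2 * PI).
Proof.
  intros HF HX HA Hg Hf H.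
  assert (HX' : forall z, HM z -> X z = reeb z)
    by (intros z Hz; apply (is_reeb_unique F); assumption).
  apply (fiber_integral_katok F); trivial; intros t.
  rewrite (angle_volume_unique F alpha Omega) by assumption.
  rewrite <- (Lie_Lie_fiber X f g p e t HX' Hg Hf H); unfold fiber_mass; ring.
Qed.

(** This makes the Laplacian a function of the base point alone. *)
Lemma RInt_katok_profile_rotate (g : vec -> R) (p e e' : vec) :
  smooth g -> HM (p, e) -> HM (p, e') ->
  RInt (katok_profile g p e') 0 (2 * PI) = RInt (katok_profile g p e) 0 (2 * PI).
Proof.
  intros Hg H H'; destruct (fiber_pt_surjective p e e' H H') as [a ->].
  pose proof (slack_fiber p e H) as Es; pose proof (slack_pos p) as Hs.
  rewrite <- (RInt_shift (katok_profile g p e) a).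
  - apply RInt_ext; intros t _.
    assert (HX : forall z, HM z -> reeb z = reeb z) by reflexivity.
    rewrite <- (Lie_Lie_fiber _ g g p _ t HX Hg (fun _ _ => eq_refl) H').
    rewrite fiber_pt_rotate by exact H.
    exact (Lie_Lie_fiber _ g g p e (t + a) HX Hg (fun _ _ => eq_refl) H).
  - intros t; apply fiber_profile_continuous; lra.
  - intros t; apply fiber_profile_periodic.
Qed.

Lemma finsler_laplacian_exists (F : vec -> vec -> R) :
  is_katok_ziller eps F -> exists Delta, is_finsler_laplacian F Delta.
Proof.
  intros HF.
  pose proof (is_reeb_reeb F HF) as HX.
  pose proof (is_angle_volume_katok F HF) as HA.
  exists (fun f p => 2 / (2 * PI) * fiber_integral F
    (fun z w => Lie reeb (Lie reeb (fun z' => f (fst z'))) z * angle_form z w)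
    p (some_direction p)).
  exists reeb, angle_form, katok_volume; split3; trivial.
  intros f (g & Hg & Hf) p e H; f_equal.
  assert (H0 : HM (p, some_direction p)) by (apply some_direction_HM, H).
  rewrite !(fiber_integral_Lie F reeb angle_form katok_volume f g)
    by assumption.
  apply RInt_katok_profile_rotate; assumption.
Qed.

(** With [e] on the meridian, [p x e] is horizontal, so that [B = 0]. *)
Lemma RInt_katok_profile_sph (g : vec -> R) (phi theta : R) :
  sin phi <> 0 ->
  let p := sph phi theta in let e := sph_phi phi theta in let n := sph_unit_theta theta in
  let l := sqrt (slack p) in
  RInt (katok_profile g p e) 0 (2 * PI) =
  2 * PI / (1 + l) *
    (l ^ 2 * (hess g p e e - dirD p g p) + l ^ 3 * (hess g p n n - dirD p g p)
     + eps ^ 2 * sin phi * cos phi * (1 + l) * dirD e g p).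
Proof.
  intros Hphi p e n l.
  pose proof (slack_pos p) as Hs; pose proof (sqrt_lt_R0 _ Hs) as Hl; fold l in Hl.
  assert (Hll : l ^ 2 = slack p) by (rewrite <- Rsqr_pow2; apply Rsqr_sqrt; lra).
  assert (Ecz : cz p = cos phi) by reflexivity.
  assert (Esl : slack p = 1 - (eps * - sin phi) ^ 2).
  { unfold slack; rewrite Ecz; pose proof (sin2_cos2 phi) as E; unfold Rsqr in E.
    replace (1 - cos phi ^ 2) with (sin phi ^ 2) by lra; ring. }
  unfold katok_profile; fold l; rewrite <- Hll.
  subst p e; rewrite normal_sph; fold n; set (p := sph phi theta) in *.
  set (e := sph_phi phi theta) in *.
  change (cz e) with (- sin phi); replace (eps * cz n) with 0 by (unfold n, sph_unit_theta, mkvec, cz; cbn; ring).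
  rewrite Ecz; set (A := eps * - sin phi) in *.
  assert (HA : A <> 0) by (unfold A; apply Rmult_integral_contrapositive_currified; lra).
  rewrite RInt_fiber_profile by nra.
  replace (1 - A ^ 2 - 0 ^ 2) with (l ^ 2) by lra.
  set (k := dirD p g p + eps * cos phi * (A * dirD e g p + 0 * dirD n g p) / l ^ 2).
  set (h := hess g p e n + hess g p n e).
  transitivity (RInt (fun t => fiber_second (l ^ 2 * l * (hess g p e e - k)) (l ^ 2 * l * h)
    (l ^ 2 * l * (hess g p n n - k)) t / fiber_root A 0 t ^ 2) 0 (2 * PI)).
  - apply RInt_ext; intros t _; unfold fiber_second; pose proof (sin2_cos2 t) as E; unfold Rsqr in E.
    apply (f_equal (fun x => x / fiber_root A 0 t ^ 2)).
    replace (_ - eps * cos phi * (A * dirD e g p + 0 * dirD n g p) / l ^ 2)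
      with (cos t ^ 2 * hess g p e e + cos t * sin t * h + sin t ^ 2 * hess g p n n
            - k * (sin t * sin t + cos t * cos t)) by (rewrite E; unfold k; ring).
    ring.
  - rewrite (RInt_second_over_root_sq A l) by (trivial; lra).
    unfold k, A; real_field; lra.
Qed.
End Katok.

Theorem theorem5p8 (eps : R) (Heps : 0 < eps < 1)
    (F : vec -> vec -> R) (HF : is_katok_ziller eps F) :
  (exists Delta : (vec -> R) -> vec -> R, is_finsler_laplacian F Delta) /\
  forall Delta : (vec -> R) -> vec -> R, is_finsler_laplacian F Delta ->
  forall f : vec -> R, smooth_on_S2 f ->
  forall phi theta : R, 0 < phi < PI ->
    Delta f (sph phi theta) =
    2 / (1 + sqrt (1 - eps ^ 2 * sin phi ^ 2)) *
    (Rpower (1 - eps ^ 2 * sin phi ^ 2) (3 / 2) / sin phi ^ 2 *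
       Derive_n (fun t => f (sph phi t)) 2 theta
     + (1 - eps ^ 2 * sin phi ^ 2) * Derive_n (fun t => f (sph t theta)) 2 phi
     + cos phi / sin phi *
       (eps ^ 2 * sin phi ^ 2 + sqrt (1 - eps ^ 2 * sin phi ^ 2)) *
       Derive (fun t => f (sph t theta)) phi).
Proof.
  split; [exact (finsler_laplacian_exists eps Heps F HF) | ].
  intros Delta (X & alpha & Omega & HX & HA & HD) f Hf phi theta Hphi.
  assert (Hsin : 0 < sin phi) by (apply sin_gt_0; lra).
  assert (Esl : slack eps (sph phi theta) = 1 - eps ^ 2 * sin phi ^ 2).
  { unfold slack; change (cz (sph phi theta)) with (cos phi).
    pose proof (sin2_cos2 phi) as E; unfold Rsqr in E.
    replace (1 - cos phi ^ 2) with (sin phi ^ 2) by lra; reflexivity. }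
  pose proof (slack_pos eps Heps (sph phi theta)) as Hs; rewrite Esl in Hs.
  rewrite (HD f Hf _ _ (sph_HM phi theta)); destruct Hf as (g & Hg & Hf).
  rewrite (fiber_integral_Lie eps Heps F X alpha Omega f g) by (trivial; apply sph_HM).
  rewrite RInt_katok_profile_sph by lra.
  rewrite (Derive_sph f g), (Derive_2_sph_phi f g), (Derive_2_sph_theta f g) by assumption.
  rewrite Esl; set (lam := 1 - eps ^ 2 * sin phi ^ 2) in *.
  assert (Epow : Rpower lam (3 / 2) = sqrt lam ^ 3).
  { replace (3 / 2) with (1 + / 2) by field.
    rewrite Rpower_plus, Rpower_1, Rpower_sqrt by exact Hs.
    rewrite <- (sqrt_sqrt lam) at 1 by lra; ring. }
  rewrite Epow; pose proof (sqrt_lt_R0 _ Hs) as Hl; set (l := sqrt lam) in *.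
  assert (Hll : lam = l ^ 2) by (symmetry; rewrite <- Rsqr_pow2; apply Rsqr_sqrt; lra).
  assert (Hw : eps ^ 2 * sin phi ^ 2 = 1 - l ^ 2) by (rewrite <- Hll; unfold lam; ring).
  pose proof PI_RGT_0 as Hpi.
  replace (eps ^ 2 * sin phi * cos phi * (1 + l))
    with (eps ^ 2 * sin phi ^ 2 * cos phi * (1 + l) / sin phi) by (field; lra).
  rewrite Hw, Hll; field; lra.
Qed.
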